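(* Assume that $f,h\in C^1_{\mathrm{loc}}(\mathbb R)$ and that $\Omega\setminus\Sigma$ has the $\widetilde W^{1,2}$-extension property, and let $U$ be the (local) strong solution of problem (P). Let $\alpha>2$ and suppose that there exist constants $C_f,C_h,C_f',C_h'\ge0$ such that for all $\tau\in\mathbb R$ $$g_\alpha(\tau)=f(\tau)\tau-\alpha\overline f(\tau)\le-C_f\tau^2+C_f',\qquad l_\alpha(\tau)=h(\tau)\tau-\alpha\overline h(\tau)\ge C_h\tau^2-C_h',$$ where $\overline f(\tau)=\int_0^\tau f(y)\,dy$, $\overline h(\tau)=\int_0^\tau h(y)\,dy$. Then there exist constants $D_1>0$, $D_2>0$ (depending only on $\mu_\Sigma(\Sigma)$, $|\Omega|$, the constants $C_f,C_h,C_f',C_h'$ and $\alpha$) such that for any initial datum $U_0\in D(\mathcal A_{\Theta,\Sigma})\cap\mathbb X^\infty(\Omega,\Sigma)$ satisfying $$D_1\|U_0\|^2_{\mathbb X^2(\Omega,\Sigma)}>\alpha E(0)+D_2,$$ the strong solution $U$ of (P) blows up in finite time.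
   Context: Geometry. $\Omega\subset\mathbb R^N$ is a bounded domain with Lipschitz continuous boundary, disjointly decomposed as $\partial\Omega=\Gamma_D\cup\Gamma_N$, with outer unit normal $\nu$ and surface measure $\sigma$. $\Omega=\Omega_1\cup\Sigma\cup\Omega_2$, where $\Omega_1,\Omega_2$ are disjoint domains and $\Sigma=\overline{\Omega_1}\cap\overline{\Omega_2}\subset\Omega$ is relatively closed, of Hausdorff dimension $d\in(N-2,N)\cap(0,N)$ with $\mathcal H^d(\Sigma)<\infty$. $\mu_\Sigma$ is the restriction of the Hausdorff measure $\mathcal H^d$ to $\Sigma$; it satisfies $\mu_\Sigma(\Sigma)>0$ and is an upper $d$-Ahlfors measure (there is $C>0$ with $\mu_\Sigma(B(x,r)\cap\Sigma)\le Cr^d$ for all $x\in\Sigma$, $r\in(0,1]$). $|\Omega|$ is the Lebesgue measure of $\Omega$. Coefficients. $\mathbf D=(d_{ij}(x))$ is a symmetric, bounded, measurable matrix with $\langle\mathbf D v,v\rangle\ge d_0|v|^2$ for all $v\in\mathbb R^N$, for some $d_0>0$. $\beta\in L^\infty(\Sigma,\mu_\Sigma)$ with $\beta(x)\ge\beta_0>0$ for $\mu_\Sigma$-a.e. $x$. $s\in(0,1)$ and $K:\Sigma\times\Sigma\to\mathbb R_+$ is symmetric with $c_0\le K(x,y)|x-y|^{d+2s}\le c_1$ for all $x\ne y$ in $\Sigma$, for constants $0<c_0\le c_1$. Spaces. $\widetilde W^{1,2}(\Omega\setminus\Sigma)$ is the closure of $W^{1,2}(\Omega\setminus\Sigma)\cap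 C(\overline\Omega)$ in $W^{1,2}(\Omega\setminus\Sigma)$. $\Omega\setminus\Sigma$ has the $\widetilde W^{1,2}$-extension property if every $u\in\widetilde W^{1,2}(\Omega\setminus\Sigma)$ is the restriction of some function in $W^{1,2}(\mathbb R^N)$. $W^{1,2}_{0,\Gamma_D}(\Omega\setminus\Sigma)$ is the closure in $W^{1,2}(\Omega\setminus\Sigma)$ of $\{u\in W^{1,2}(\Omega\setminus\Sigma)\cap C(\overline\Omega):u=0\text{ on }\Gamma_D\}$. Under the $\widetilde W^{1,2}$-extension property, $u|_\Sigma\in L^2(\Sigma,\mu_\Sigma)$ is the trace of $u\in\widetilde W^{1,2}(\Omega\setminus\Sigma)$ (continuous extension of the restriction map on continuous functions). $\mathbb B^2_{d,s}(\Sigma,\mu_\Sigma)$ is the space of $u\in L^2(\Sigma,\mu_\Sigma)$ with $\int_\Sigma\int_\Sigma\frac{|u(x)-u(y)|^2}{|x-y|^{d+2s}}d\mu_\Sigma(x)d\mu_\Sigma(y)<\infty$. $\mathbb X^r(\Omega,\Sigma)=L^r(\Omega)\times L^r(\Sigma,\mu_\Sigma)$ with norm $(\|f\|_{L^r(\Omega)}^r+\|g\|_{L^r(\Sigma)}^r)^{1/r}$ for $r<\infty$ and $\max\{\|f\|_\infty,\|g\|_\infty\}$ for $r=\infty$. Form and operator. $D(\mathcal A_{\Theta,\Sigma})=\{U=(u,u|_\Sigma):u\in W^{1,2}_{0,\Gamma_D}(\Omega\setminus\Sigma),\ u|_\Sigma\in\mathbb B^2_{d,s}(\Sigma,\mu_\Sigma)\}$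 and, for $U=(u,u|_\Sigma)$, $\Phi=(\varphi,\varphi|_\Sigma)$, $$\mathcal A_{\Theta,\Sigma}(U,\Phi)=\int_{\Omega\setminus\Sigma}\mathbf D\nabla u\cdot\nabla\varphi\,dx+\int_\Sigma\beta u\varphi\,d\mu_\Sigma+\int_\Sigma\int_\Sigma K(x,y)(u(x)-u(y))(\varphi(x)-\varphi(y))\,d\mu_\Sigma(x)d\mu_\Sigma(y).$$ $D(\mathcal A_{\Theta,\Sigma})$ is normed by $\|U\|^2=\mathcal A_{\Theta,\Sigma}(U,U)$ (equivalent to the full form norm). $A_{\Theta,\Sigma}$ is the self-adjoint operator on $\mathbb X^2(\Omega,\Sigma)$ associated with this form. Problem (P). Formally: $\partial_tu-\mathrm{div}(\mathbf D\nabla u)+f(u)=0$ in $(0,T)\times(\Omega\setminus\Sigma)$; $u=0$ on $(0,T)\times\Gamma_D$; $(\mathbf D\nabla u)\cdot\nu=0$ on $(0,T)\times\Gamma_N$; $dN_{\mathbf D}(u)+(\partial_tu+\beta u+\Theta_\Sigma(u))d\mu_\Sigma=h(u)d\mu_\Sigma$ on $(0,T)\times\Sigma$, where $N_{\mathbf D}(u)$ is the generalized $\mathbf D$-normal derivative measure on $\Sigma$ and $\langle\Theta_\Sigma(u),v\rangle=\iint_{\Sigma\times\Sigma}K(x,y)(u(x)-u(y))(v(x)-v(y))d\mu_\Sigma d\mu_\Sigma$; initial datum $U_0=(u_0,v_0)$. The precise meaning is given by the following notion. Strong solution. For $(u_0,v_0)\in\mathbb X^\infty(\Omega,\Sigma)$,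 $U=(u,u|_\Sigma)$ is a strong solution of (P) on an interval $(0,T_* )$ if for every $T\in(0,T_* )$: (1) $U\in W^{1,\infty}_{\mathrm{loc}}((0,T];\mathbb X^2(\Omega,\Sigma))\cap C([0,T];\mathbb X^\infty(\Omega,\Sigma))\cap C_{\mathrm{loc}}((0,T];D(\mathcal A_{\Theta,\Sigma}))$ and $U(t)\in D(A_{\Theta,\Sigma})$ for a.e. $t\in(0,T)$; (2) for all $\xi=(\xi,\xi|_\Sigma)\in D(\mathcal A_{\Theta,\Sigma})$ and a.e. $t\in(0,T)$, $\int_{\Omega\setminus\Sigma}\partial_tu\,\xi\,dx+\int_\Sigma\partial_tu\,\xi|_\Sigma\,d\mu_\Sigma+\mathcal A_{\Theta,\Sigma}(U(t),\xi)+\int_{\Omega\setminus\Sigma}f(u(t))\xi\,dx=\int_\Sigma h(u(t)|_\Sigma)\xi|_\Sigma\,d\mu_\Sigma$; (3) $(u(t),u(t)|_\Sigma)\to(u_0,v_0)$ strongly in $\mathbb X^\infty(\Omega,\Sigma)$ as $t\to0^+$. For $f,h\in C^1_{\mathrm{loc}}(\mathbb R)$ and under the $\widetilde W^{1,2}$-extension property, there is a unique strong solution on a maximal interval $(0,T_{\max})$, with $\|U(t)\|_{\mathbb X^\infty}\to\infty$ as $t\uparrow T_{\max}$ if $T_{\max}<\infty$. Blow-up in finite time means $T_{\max}<\infty$. Energy. $E(t)=\frac12\mathcal A_{\Theta,\Sigma}(U(t),U(t))+\int_{\Omega\setminus\Sigma}\overline f(u(t))\,dx-\int_\Sigma\overline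 h(u(t))\,d\mu_\Sigma$, so $E(0)$ is this expression evaluated at $U_0$.
   Formalization: If C_f=0 or C_h=0, D_1 and D_2 may also depend on a constant κ>0 with κ‖U‖²_{X²} ≤ A_{Θ,Σ}(U,U) on D(A_{Θ,Σ}); with only the listed dependence the claim fails there (f=h=0 and small D, β, K give global solutions). *)

(* Defs.v *)
From HB Require Import structures.
From mathcomp Require Import all_boot all_order all_algebra.
From mathcomp Require Import all_classical all_reals all_analysis.
Set Implicit Arguments.
Unset Strict Implicit.
Unset Printing Implicit Defensive.
Import Order.TTheory GRing.Theory Num.Theory.
Import numFieldNormedType.Exports.
Local Open Scope classical_set_scope.
Local Open Scope ring_scope.

(* R^N with its Borel sigma-algebra. *)
Notation borelRn R N := (g_sigma_algebraType (@open 'rV[R]_N)).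

Section Euclidean.
Variables (R : realType) (N : nat).
Local Notation E := 'rV[R]_N.

Definition dotv (v w : E) : R := \sum_(i < N) v 0 i * w 0 i.

(* The norm MathComp-Analysis puts on row vectors is the sup norm. *)
Definition enorm (v : E) : R := Num.sqrt (dotv v v).

Definition eball (x : E) (r : R) : set E := [set y | enorm (y - x) < r].

Definition domain (O : set E) : Prop := [/\ open O, connected O & O !=set0].

Definition bdry (O : set E) : set E := closure O `\` interior O.

(* Near p, O is the strict epigraph, in the direction of the unit vector e, of
   a Lipschitz function g of the hyperplane orthogonal to e (extended to R^N
   constantly along e). *)
Definition lipschitz_boundary (O : set E) : Prop :=
  forall p, bdry O p ->
  exists (r : R) (e : E) (g : E -> R) (L : R),
    [/\ 0 < r, enorm e = 1,
        forall x t, g (x + t *: e) = g x,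
        forall x y, `|g x - g y| <= L * enorm (x - y)
      & forall x, eball p r x -> (O x <-> g x < dotv x e)].

Definition ediam (F : set E) : \bar R :=
  ereal_sup [set z | z = 0%E \/
                     exists x y, [/\ F x, F y & z = (enorm (x - y))%:E]].

(* Hausdorff (outer) measure, normalised without dimensional constant. *)
Definition hausdorff_pre (d delta : R) (A : set E) : \bar R :=
  ereal_inf [set z | exists F : nat -> set E,
    [/\ A `<=` \bigcup_i F i,
        forall i, (ediam (F i) <= delta%:E)%E
      & z = (\sum_(0 <= i <oo) (ediam (F i) `^ d))%E]].

Definition hausdorff (d : R) (A : set E) : \bar R :=
  ereal_sup [set hausdorff_pre d delta A | delta in [set delta | 0 < delta]].

Definition hausdorff_dim (A : set E) : \bar R :=
  ereal_inf [set d%:E | d in [set d | 0 < d /\ hausdorff d A = 0%E]].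

(* The Borel measure giving boxes their volume, i.e. Lebesgue measure. *)
Definition is_lebesgue (lam : set (borelRn R N) -> \bar R) : Prop :=
  forall a b : E, (forall i, a 0 i <= b 0 i) ->
    lam [set x : E | forall i, a 0 i <= x 0 i <= b 0 i] =
    (\prod_(i < N) (b 0 i - a 0 i))%:E.

Definition partial (i : 'I_N) (phi : E -> R) : E -> R :=
  fun x => 'D_(delta_mx 0 i) phi x.

(* C^oo : every iterated partial derivative exists and is continuous. *)
Definition smooth (phi : E -> R) : Prop :=
  forall s : seq 'I_N, let psi := foldr partial phi s in
    continuous psi /\ forall i x, derivable psi x (delta_mx 0 i).

Definition test_function (O : set E) (phi : E -> R) : Prop :=
  smooth phi /\
  exists C : set E, [/\ compact C, C `<=` O & forall x, ~ C x -> phi x = 0].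

End Euclidean.

(* Raw data; the standing assumptions on them are [geometry] and
   [coefficients] below, where lam is required to be Lebesgue measure and muS
   the restriction of the Hausdorff measure to Sigma (both are thereby
   determined on Borel sets). *)
Record problem (R : realType) (N : nat) := Problem {
  Om : set 'rV[R]_N;
  Om1 : set 'rV[R]_N;
  Om2 : set 'rV[R]_N;
  Sg : set 'rV[R]_N;
  GamD : set 'rV[R]_N;
  GamN : set 'rV[R]_N;
  lam : {measure set (borelRn R N) -> \bar R};
  muS : {finite_measure set (borelRn R N) -> \bar R};
  dS : R;
  Dm : 'rV[R]_N -> 'M[R]_N;
  betaS : 'rV[R]_N -> R;
  sK : R;
  kern : 'rV[R]_N -> 'rV[R]_N -> R }.

Section Problem.
Variables (R : realType) (N : nat) (P : problem R N).
Local Notation E := 'rV[R]_N.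
Local Notation B := (borelRn R N).

Definition OmS : set E := Om P `\` Sg P.

Definition Dform (x v w : E) : R :=
  \sum_(i < N) \sum_(j < N) Dm P x i j * v 0 j * w 0 i.

Record geometry : Prop := {
  Om_domain : domain (Om P);
  Om_bounded : exists M, forall x, Om P x -> enorm x <= M;
  Om_lipschitz : lipschitz_boundary (Om P);
  bdry_split : bdry (Om P) = GamD P `|` GamN P;
  bdry_disj : GamD P `&` GamN P = set0;
  Om_split : Om P = Om1 P `|` Sg P `|` Om2 P;
  Om1_domain : domain (Om1 P);
  Om2_domain : domain (Om2 P);
  Om12_disj : Om1 P `&` Om2 P = set0;
  Sg_def : Sg P = closure (Om1 P) `&` closure (Om2 P);
  Sg_sub : Sg P `<=` Om P;
  dS_gtN2 : N%:R - 2 < dS P;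
  dS_ltN : dS P < N%:R;
  dS_gt0 : 0 < dS P;
  Sg_dim : hausdorff_dim (Sg P) = (dS P)%:E;
  Sg_fin : (hausdorff (dS P) (Sg P) < +oo)%E;
  lam_lebesgue : is_lebesgue (lam P);
  muS_hausdorff : forall A : set B, measurable A ->
    muS P A = hausdorff (dS P) (A `&` Sg P);
  muS_gt0 : (0 < muS P (Sg P))%E;
  muS_ahlfors : exists2 C : R, 0 < C & forall x r, Sg P x -> 0 < r <= 1 ->
    (muS P (eball x r `&` Sg P) <= (C * r `^ dS P)%:E)%E }.

Record coefficients : Prop := {
  Dm_sym : forall x, Om P x -> ((Dm P x)^T = Dm P x)%R;
  Dm_meas : forall i j, measurable_fun (Om P : set B) (fun x : B => Dm P x i j);
  Dm_bounded : exists C, forall x i j, Om P x -> `|Dm P x i j| <= C;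
  Dm_elliptic : exists2 d0 : R, 0 < d0 &
    forall x v, Om P x -> d0 * enorm v ^+ 2 <= Dform x v v;
  beta_meas : measurable_fun (Sg P : set B) (betaS P : B -> R);
  beta_bounds : exists b0 b1 : R, 0 < b0 /\
    {ae muS P, forall x, Sg P x -> b0 <= betaS P x <= b1};
  sK_range : 0 < sK P < 1;
  K_meas : measurable_fun ((Sg P `*` Sg P) : set (B * B))
    (fun z : B * B => kern P z.1 z.2);
  K_ge0 : forall x y, Sg P x -> Sg P y -> 0 <= kern P x y;
  K_sym : forall x y, Sg P x -> Sg P y -> kern P x y = kern P y x;
  K_bounds : exists c0 c1 : R, [/\ 0 < c0, c0 <= c1 &
    forall x y, Sg P x -> Sg P y -> x <> y ->
      c0 <= kern P x y * enorm (x - y) `^ (dS P + 2 * sK P) <= c1] }.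

(* Elements of function spaces are represented by Borel functions (equality is
   almost everywhere); a Sobolev function is carried together with its weak
   gradient, which it determines almost everywhere. *)
Local Notation sob := ((E -> R) * (E -> E))%type.
Local Notation Xpair := ((E -> R) * (E -> R))%type.
(* (u, grad u, trace of u on Sigma) *)
Local Notation state := ((E -> R) * (E -> E) * (E -> R))%type.

Definition toX (U : state) : Xpair := (U.1.1, U.2).

Definition weak_gradient (O : set E) (v : sob) : Prop :=
  forall phi, test_function O phi -> forall i,
    \int[lam P]_(x in O) (v.1 x * partial i phi x) =
    - \int[lam P]_(x in O) (v.2 x 0 i * phi x).

Definition W12norm2 (O : set E) (v : sob) : \bar R :=
  (\int[lam P]_(x in O) (v.1 x ^+ 2 + enorm (v.2 x) ^+ 2)%:E)%E.

Definition W12 (O : set E) (v : sob) : Prop :=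
  [/\ measurable_fun (O : set B) (v.1 : B -> R),
      forall i, measurable_fun (O : set B) (fun x : B => v.2 x 0 i),
      (W12norm2 O v < +oo)%E
    & weak_gradient O v].

Definition W12_closure (O : set E) (S : set sob) : set sob :=
  [set v | W12 O v /\
           forall e : R, 0 < e -> exists2 w, S w & (W12norm2 O (v - w)%R < e%:E)%E].

(* W^{1,2}(Omega \ Sigma) `&` C(closure Omega) *)
Definition W12_cont (v : sob) : Prop :=
  W12 OmS v /\ {within closure (Om P), continuous v.1}.

Definition W12_tilde : set sob := W12_closure OmS W12_cont.

Definition W12_0D : set sob :=
  W12_closure OmS [set v | W12_cont v /\ forall x, GamD P x -> v.1 x = 0].

Definition extension_property : Prop :=
  forall v, W12_tilde v -> exists2 V : sob, W12 setT V &
    {ae lam P, forall x, OmS x -> V.1 x = v.1 x}.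

Definition SgL2norm2 (w : E -> R) : \bar R :=
  (\int[muS P]_(x in Sg P) (w x ^+ 2)%:E)%E.

Definition SgL2 (w : E -> R) : Prop :=
  measurable_fun (Sg P : set B) (w : B -> R) /\ (SgL2norm2 w < +oo)%E.

(* Graph of the continuous extension to W12_tilde of v |-> v restricted to
   Sigma on W12_cont; single-valued (mu-a.e.) under [extension_property]. *)
Definition is_trace (v : sob) (w : E -> R) : Prop :=
  SgL2 w /\
  exists vn : nat -> sob,
    [/\ forall n, W12_cont (vn n),
        W12norm2 OmS (vn n - v) @[n --> \oo] --> 0%E
      & SgL2norm2 ((vn n).1 - w) @[n --> \oo] --> 0%E].

Definition besov (w : E -> R) : Prop :=
  SgL2 w /\
  (\int[muS P \x muS P]_(z in (Sg P `*` Sg P : set (B * B)))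
     ((w z.1 - w z.2) ^+ 2 / enorm (z.1 - z.2 : E) `^ (dS P + 2 * sK P))%:E
   < +oo)%E.

Definition Lp (mu : {measure set B -> \bar R}) (D : set E) (p : \bar R)
    (u : E -> R) : \bar R :=
  Lnorm mu p (EFin \o (u \_ D) : B -> \bar R).

Definition Xnorm (p : \bar R) (U : Xpair) : \bar R :=
  match p with
  | r%:E => ((Lp (lam P) (Om P) p U.1 `^ r + Lp (muS P) (Sg P) p U.2 `^ r)
               `^ r^-1)%E
  | _ => maxe (Lp (lam P) (Om P) p U.1) (Lp (muS P) (Sg P) p U.2)
  end.

Definition inX (p : \bar R) (U : Xpair) : Prop :=
  [/\ measurable_fun (Om P : set B) (U.1 : B -> R),
      measurable_fun (Sg P : set B) (U.2 : B -> R)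
    & (Xnorm p U < +oo)%E].

Definition X2dot (U V : Xpair) : R :=
  \int[lam P]_(x in Om P) (U.1 x * V.1 x) +
  \int[muS P]_(x in Sg P) (U.2 x * V.2 x).

Definition form_dom (U : state) : Prop :=
  [/\ W12_0D U.1, is_trace U.1 U.2 & besov U.2].

Definition form (U V : state) : R :=
  \int[lam P]_(x in OmS) Dform x (U.1.2 x) (V.1.2 x) +
  \int[muS P]_(x in Sg P) (betaS P x * U.2 x * V.2 x) +
  \int[(muS P \x muS P)%E]_(z in (Sg P `*` Sg P : set (B * B)))
     (kern P z.1 z.2 * (U.2 z.1 - U.2 z.2) * (V.2 z.1 - V.2 z.2)).

(* kappa is a constant of the equivalence between the norm form(U, U)^(1/2) of
   the form domain and the full form norm (form(U, U) + |U|_{X^2}^2)^(1/2);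
   for kappa = 0 this says nothing. *)
Definition form_norm_equiv (kappa : R) : Prop :=
  forall U, form_dom U -> kappa * fine (Xnorm 2%:E (toX U)) ^+ 2 <= form U U.

Definition op_dom (U : state) : Prop :=
  form_dom U /\
  exists2 F, inX 2%:E F & forall V, form_dom V -> form U V = X2dot F (toX V).

Definition antideriv (g : R -> R) (t : R) : R :=
  if 0 <= t then \int[lebesgue_measure]_(y in `[0, t]) g y
  else - \int[lebesgue_measure]_(y in `[t, 0]) g y.

Definition energy (f h : R -> R) (U : state) : R :=
  2^-1 * form U U + \int[lam P]_(x in OmS) antideriv f (U.1.1 x)
  - \int[muS P]_(x in Sg P) antideriv h (U.2 x).

Definition simple_X2 (S : R -> Xpair) : Prop :=
  exists (k : nat) (A : 'I_k -> set R) (F : 'I_k -> Xpair),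
    [/\ forall i, measurable (A i), forall i, inX 2%:E (F i)
      & forall t, S t = \sum_(i < k) (\1_(A i) t : R) *: F i].

Definition strongly_measurable_X2 (T : R) (V : R -> Xpair) : Prop :=
  exists2 S : nat -> R -> Xpair, forall n, simple_X2 (S n) &
    {ae lebesgue_measure, forall t : R, 0 < t < T ->
       inX 2%:E (V t) /\ Xnorm 2%:E (S n t - V t) @[n --> \oo] --> 0%E}.

(* L^oo_loc((0, T]; X^2) *)
Definition Loo_loc_X2 (T : R) (V : R -> Xpair) : Prop :=
  strongly_measurable_X2 T V /\
  forall a, 0 < a < T -> exists C : R,
    {ae lebesgue_measure, forall t : R, a < t < T ->
       (Xnorm 2%:E (V t) <= C%:E)%E}.

Definition time_test (T : R) (eta : R -> R) : Prop :=
  [/\ forall t, derivable eta t 1, continuous (derive1 eta)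
    & exists a b, [/\ 0 < a, b < T & forall t, ~ (a <= t <= b) -> eta t = 0]].

(* U in W^{1,oo}_loc((0, T]; X^2) with weak time derivative V.  The vector
   identity \int eta' U = - \int eta V is tested against all elements of X^2. *)
Definition W1oo_loc_X2 (T : R) (U V : R -> Xpair) : Prop :=
  [/\ Loo_loc_X2 T U, Loo_loc_X2 T V &
    forall eta F, time_test T eta -> inX 2%:E F ->
      \int[lebesgue_measure]_(t in `]0, T[) (derive1 eta t * X2dot (U t) F) =
      - \int[lebesgue_measure]_(t in `]0, T[) (eta t * X2dot (V t) F)].

Definition cont_Xoo (T : R) (U : R -> Xpair) : Prop :=
  forall t0, 0 <= t0 <= T -> inX +oo%E (U t0) /\
    Xnorm +oo%E (U t - U t0) @[t --> within `[0, T] (nbhs t0)] --> 0%E.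

(* C_loc((0, T]; form domain) *)
Definition cont_form_dom (T : R) (U : R -> state) : Prop :=
  forall t0, 0 < t0 <= T -> form_dom (U t0) /\
    form (U t - U t0) (U t - U t0) @[t --> within `]0, T] (nbhs t0)] --> (0 : R).

Definition weak_equation (f h : R -> R) (T : R) (U : R -> state)
    (V : R -> Xpair) : Prop :=
  forall xi, form_dom xi ->
  {ae lebesgue_measure, forall t : R, 0 < t < T ->
    \int[lam P]_(x in OmS) ((V t).1 x * xi.1.1 x) +
    \int[muS P]_(x in Sg P) ((V t).2 x * xi.2 x) +
    form (U t) xi +
    \int[lam P]_(x in OmS) (f ((U t).1.1 x) * xi.1.1 x) =
    \int[muS P]_(x in Sg P) (h ((U t).2 x) * xi.2 x)}.

(* Strong solution on (0, Ts) with initial datum U0; the gradient component of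
   U t is only meaningful for t > 0. *)
Definition strong_solution (f h : R -> R) (U0 : Xpair) (Ts : \bar R)
    (U : R -> state) : Prop :=
  [/\ inX +oo%E U0, (0 < Ts)%E &
  forall T : R, 0 < T -> (T%:E < Ts)%E ->
    exists V : R -> Xpair,
    [/\ W1oo_loc_X2 T (toX \o U) V,
        cont_Xoo T (toX \o U),
        cont_form_dom T U,
        {ae lebesgue_measure, forall t : R, 0 < t < T -> op_dom (U t)} &
        weak_equation f h T U V /\
        Xnorm +oo%E (toX (U t) - U0) @[t --> 0^'+] --> 0%E]].

Definition maximal_strong_solution (f h : R -> R) (U0 : Xpair) (Tmax : \bar R)
    (U : R -> state) : Prop :=
  strong_solution f h U0 Tmax U /\
  forall Ts W, strong_solution f h U0 Ts W -> (Ts <= Tmax)%E.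

End Problem.

Definition C1 (R : realType) (g : R -> R) : Prop :=
  (forall t, derivable g t 1) /\ continuous (derive1 g).

(* Main.v *)
Require Import Defs.
From HB Require Import structures.
From mathcomp Require Import all_boot all_order all_algebra.
From mathcomp Require Import all_classical all_reals all_analysis.
From mathcomp Require Import ring lra measurable_realfun ess_sup_inf.
Set Implicit Arguments.
Unset Strict Implicit.
Unset Printing Implicit Defensive.
Import Order.TTheory GRing.Theory Num.Theory.
Import numFieldNormedType.Exports.
Local Open Scope classical_set_scope.
Local Open Scope ring_scope.

(** Blow-up of solutions of the transmission problem with large initial data.

Write the problem as [U' = F (U) - A U] in X^2, with [A] the operator of the
form [a], and [E = a (U, U) / 2 + Psi (U)].  Suppose that the solution exists
for all times.  The proof is Levine's concavity argument, with
[y = |U| ^ 2 / 2] and [q = D1 * |U| ^ 2 - alpha * E - D2].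

- Testing the equation with [U], the structural conditions on [f] and [h] give
  [y' >= q] ([energy_growth]).  Here
  [D1 = (alpha / 2 - 1) * kappa + min (Cf, Ch)]: the first part comes from the
  share of the form that [alpha * E], with [alpha > 2], leaves over.
- Dissipation, [- E' >= |U'| ^ 2], and Cauchy-Schwarz, [y' ^ 2 <= 2 y |U'| ^ 2],
  give [y q' >= (alpha / 2) y' ^ 2].
- Hence [(y / q)' <= - (alpha / 2 - 1)] as long as [q > 0], and the positive
  function [y / q] would vanish in finite time ([levine_riccati]).
- The hypothesis on the initial datum says that [q > 0] at time zero.

The solution is only weakly differentiable into X^2 and continuous into the
form domain, and the latter only for positive times, so the chain rule for [E]
and the passage to time zero need an argument; both are carried out for an
abstract flow ([flow_no_blow_up_bound]).

- [t |-> (U t, xi)] is continuously differentiable with derivative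
  [L t xi = (F (U t), xi) - a (U t, xi)] for every test state [xi] and at every
  positive time: the weak identity determines the derivative almost
  everywhere, its right-hand side is continuous, and the lemma of du
  Bois-Reymond applies ([solution_derive]).  Moreover
  [|L t xi| <= C * |xi|] locally uniformly, so [U] is locally Lipschitz in X^2.
- For [s < t], convexity of [a] bounds [E s - E t] from below by
  [L t (U t - U s)] up to [O ((t - s) ^ 2)].  As [s] tends to [t] the difference
  quotients of [U] converge weakly to the vector representing [L t], which
  bounds the lower left Dini derivative of [- E] from below by
  [|L t (U t)| ^ 2 / |U t| ^ 2] ([flow_dissipation]); by
  [left_dini_nondecreasing] this is enough.  The form domain is not complete for
  the norm of X^2, so the representing vector is replaced by an approximate one
  ([approximate_riesz]).
- At time zero, if [a (U t, U t)] stayed above [a (U0, U0) + e], then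
  [|U t - U0| ^ 2] would decrease strictly from the value zero
  ([flow_initial_form]).  So [q > 0] at some positive time.

The X^2 norm is an integral over the whole of Omega, whereas the equation only
sees the complement of Sigma.  The two agree because a set of finite
d-dimensional Hausdorff measure with [d < N] is Lebesgue null
([hausdorff_lebesgue_null]). *)


(** * Positive semidefinite forms on a subspace *)

Section PsdForms.
Variables (R : realType) (V : lmodType R).
Implicit Types (D : set V) (b : V -> V -> R) (l : V -> R).

Definition subspace D : Prop :=
  forall (c : R) x y, D x -> D y -> D (c *: x + y).

Definition linear_on D l : Prop :=
  forall (c : R) x y, D x -> D y -> l (c *: x + y) = c * l x + l y.

Definition psd_on D b : Prop :=
  [/\ forall y, D y -> linear_on D (b^~ y),
      forall x y, D x -> D y -> b x y = b y x
    & forall x, D x -> 0 <= b x x].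

Lemma subspaceB D x y : subspace D -> D x -> D y -> D (x - y).
Proof. by move=> sD Dx Dy; rewrite addrC -scaleN1r; exact: sD. Qed.

Lemma linear_onB D l x y : linear_on D l -> D x -> D y -> l (x - y) = l x - l y.
Proof. by move=> ll Dx Dy; rewrite addrC -scaleN1r ll// mulN1r addrC. Qed.

Section OnePsdForm.
Variables (D : set V) (b : V -> V -> R).
Hypotheses (sD : subspace D) (bP : psd_on D b).

Lemma psdC x y : D x -> D y -> b x y = b y x.
Proof. by move=> Dx Dy; case: bP => _ + _; exact. Qed.

Lemma psd_ge0 x : D x -> 0 <= b x x.
Proof. by case: bP => + + +; auto. Qed.

Lemma psd_linearl y : D y -> linear_on D (b^~ y).
Proof. by case: bP => + + +; auto. Qed.

Lemma psd_linearr x : D x -> linear_on D (b x).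
Proof.
move=> Dx c y z Dy Dz; rewrite (psdC Dx (sD c Dy Dz)) (psd_linearl Dx)//.
by rewrite (psdC Dy Dx) (psdC Dz Dx).
Qed.

Lemma psd_expand c x y : D x -> D y ->
  b (c *: x + y) (c *: x + y) = c ^+ 2 * b x x + 2 * c * b x y + b y y.
Proof.
move=> Dx Dy; have Dz := sD c Dx Dy.
rewrite (psd_linearl Dz)// !psd_linearr//.
by rewrite (psdC Dy Dx); ring.
Qed.

Lemma psd_expandB x y : D x -> D y ->
  b (x - y) (x - y) = b x x - 2 * b x y + b y y.
Proof.
move=> Dx Dy; rewrite (addrC x) -scaleN1r psd_expand// (psdC Dy Dx).
by ring.
Qed.

Lemma discriminant_le (c p d : R) : 0 <= c -> 0 <= d ->
  (forall k : R, k * p <= k ^+ 2 * c / 2 + d) -> p ^+ 2 <= 2 * d * c.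
Proof.
move=> c0 d0 H; have [c_eq|c_neq] := eqVneq c 0.
  have [->|p0] := eqVneq p 0; first by rewrite expr0n/= !mulr_ge0.
  by have := H ((d + 1) / p); rewrite c_eq mulr0 mul0r add0r divfK//; lra.
have cgt : 0 < c by rewrite lt_neqAle eq_sym c_neq.
have := H (p / c).
rewrite -subr_ge0 -(@pmulr_rge0 _ c)// => h; rewrite -subr_ge0.
suff -> : 2 * d * c - p ^+ 2 =
  2 * (c * ((p / c) ^+ 2 * c / 2 + d - p / c * p)) by rewrite mulr_ge0.
by field.
Qed.

Lemma psd_CS x y : D x -> D y -> b x y ^+ 2 <= b x x * b y y.
Proof.
move=> Dx Dy; have := @discriminant_le (b x x) (b x y) (b y y / 2).
rewrite (_ : 2 * (b y y / 2) = b y y); last by field.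
rewrite (mulrC (b y y) (b x x)); apply; rewrite ?divr_ge0// ?psd_ge0//.
move=> k; have := psd_ge0 (sD (- k) Dx Dy); rewrite psd_expand//; lra.
Qed.

Lemma psd_CS_sqrt x y : D x -> D y ->
  `|b x y| <= Num.sqrt (b x x) * Num.sqrt (b y y).
Proof.
move=> Dx Dy; rewrite -sqrtrM ?psd_ge0// -sqrtr_sqr ler_wsqrtr//.
exact: psd_CS.
Qed.

End OnePsdForm.

(** Without completeness a bounded functional [l] need not have a representing
vector, but a near-maximiser of [l x - b x x / 2] represents it up to [e]. *)
Lemma approximate_riesz D b l (C e : R) : subspace D -> psd_on D b ->
  D !=set0 -> linear_on D l ->
  (forall x, D x -> `|l x| <= C * Num.sqrt (b x x)) -> 0 < e ->
  exists2 x, D x &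
    forall y, D y -> `|l y - b x y| <= e * Num.sqrt (b y y).
Proof.
move=> sD bP [x0 Dx0] ll lC e0.
pose J x := l x - b x x / 2.
pose S := [set J x | x in D].
have JC x : D x -> J x <= C ^+ 2 / 2.
  move=> Dx; have := lC _ Dx; have := sqr_sqrtr (psd_ge0 bP Dx).
  rewrite /J; set n := Num.sqrt _ => <- lx.
  have : l x <= C * n by exact: le_trans (ler_norm _) lx.
  have := sqr_ge0 (C - n); rewrite sqrrB; nra.
have S0 : has_sup S.
  split; first by exists (J x0), x0.
  by exists (C ^+ 2 / 2) => _ [x Dx <-]; exact: JC.
have e20 : 0 < e ^+ 2 / 2 by rewrite divr_gt0// exprn_gt0.
have [_ [x Dx <-] Jx] := sup_adherent e20 S0.
exists x => // y Dy.
have Jsup k : J (k *: y + x) <= sup S.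
  by apply: (ub_le_sup S0.2); exists (k *: y + x) => //; exact: sD.
have := @discriminant_le (b y y) (l y - b x y) (e ^+ 2 / 2) (psd_ge0 bP Dy) (ltW e20).
rewrite (_ : 2 * (e ^+ 2 / 2) = e ^+ 2); last by field.
move=> H; have {}H : (l y - b x y) ^+ 2 <= e ^+ 2 * b y y.
  apply: H => k; have := Jsup k; rewrite /J ll// (psd_expand sD bP)//.
  move: Jx; rewrite /J (psdC bP Dx Dy); lra.
rewrite -(ger0_norm (ltW e0)) -[X in X * _]sqrtr_sqr -sqrtrM ?sqr_ge0//.
by rewrite -sqrtr_sqr ler_wsqrtr.
Qed.

End PsdForms.

Lemma linear_on_sub (R : realType) (V : lmodType R) (D : set V) (l l' : V -> R) :
  linear_on D l -> linear_on D l' -> linear_on D (fun x => l x - l' x).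
Proof. by move=> ll ll' c x y Dx Dy; rewrite ll// ll'//; ring. Qed.

Lemma psd_on_sub (R : realType) (V : lmodType R) (D Z : set V) (b : V -> V -> R) :
  (forall x, D x -> Z x) -> psd_on Z b -> psd_on D b.
Proof.
move=> DZ [l s p]; split.
- by move=> y /DZ Zy c x z /DZ Zx /DZ Zz; exact: l.
- by move=> x y /DZ Zx /DZ Zy; exact: s.
- by move=> x /DZ; exact: p.
Qed.

Lemma psd_on_eq (R : realType) (V : lmodType R) (D : set V) (b b' : V -> V -> R) :
  (forall x y, b x y = b' x y) -> psd_on D b -> psd_on D b'.
Proof.
by move=> bb'; have -> : b = b' by apply/funext => x; apply/funext => y.
Qed.

Lemma psd_onD (R : realType) (V : lmodType R) (Z : set V) (b b' : V -> V -> R) :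
  psd_on Z b -> psd_on Z b' -> psd_on Z (fun U W => b U W + b' U W).
Proof.
move=> [l s p] [l' s' p']; split.
- by move=> W ZW c U U' ZU ZU'; rewrite /= l// l'//; ring.
- by move=> U W ZU ZW; rewrite s// s'.
- by move=> U ZU; rewrite addr_ge0 ?p ?p'.
Qed.

Lemma psd_pairing_cvg (R : realType) (V : lmodType R) (D : set V)
    (b : V -> V -> R) (T : Type) (F : set_system T) {FF : ProperFilter F}
    (x : T -> V) (x0 z : V) : subspace D -> psd_on D b -> D x0 -> D z ->
  (\forall s \near F, D (x s)) ->
  b (x s - x0) (x s - x0) @[s --> F] --> (0 : R) ->
  b (x s) z @[s --> F] --> b x0 z.
Proof.
move=> sD bP Dx0 Dz Dx c.
have cs : Num.sqrt (b (x s - x0) (x s - x0)) * Num.sqrt (b z z) @[s --> F] --> (0 : R).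
  rewrite -[X in _ --> X](mul0r (Num.sqrt (b z z))).
  apply: cvgM; last exact: cvg_cst.
  rewrite -[X in _ --> X]sqrtr0.
  by apply: continuous_cvg c; exact: sqrt_continuous.
apply/cvgrPdist_le => e e0.
near=> s; have Dxs : D (x s) by near: s.
rewrite distrC -(linear_onB (psd_linearl bP Dz))//.
apply: (le_trans (psd_CS_sqrt sD bP _ _)) => //; first exact: subspaceB.
rewrite -[leLHS]subr0 (le_trans (ler_norm _))// distrC.
by near: s; exact: cvgr_dist_le.
Unshelve. all: by end_near. Qed.

(** * Differential inequalities on the line *)

Section Slopes.
Variable R : realType.
Implicit Types (f g q y : R -> R).

Lemma is_derive1P f (t d : R) : is_derive t 1 f d <->
  forall e, 0 < e ->
    \forall s \near t, `|f s - f t - d * (s - t)| <= e * `|s - t|.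
Proof.
have sE (h x : R) : h *: x = h * x by [].
have E (h : R) : h != 0 ->
    `|h^-1 *: (f (h *: 1 + t) - f t) - d| =
    `|f (h + t) - f t - d * h| / `|h|.
  move=> h0; rewrite -[RHS]normf_div !sE mulr1; congr (`|_|).
  by field.
split=> [[dv dE] e e0|H].
  have : h^-1 *: (f (h *: 1 + t) - f t) @[h --> 0^'] --> d by rewrite -dE.
  move=> /cvgrPdist_le /(_ _ e0) H0.
  have {H0} H : \forall h \near (0 : R), h != 0 ->
    `|d - h^-1 *: (f (h *: 1 + t) - f t)| <= e by exact: H0.
  have H1 : \forall h \near 0, `|f (h + t) - f t - d * h| <= e * `|h|.
    near=> h; have [->|h0] := eqVneq h 0; first by rewrite add0r mulr0 subr0 subrr normr0 mulr0.
    rewrite -ler_pdivrMr ?normr_gt0// -E// distrC.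
    by move: h0; near: h.
  have : \forall s \near t, `|f ((s - t) + t) - f t - d * (s - t)| <= e * `|s - t|.
    have cc : (s - t) @[s --> t] --> 0.
      have -> : 0 = t - t :> R by rewrite subrr.
      by apply: cvgB; [exact: cvg_id|exact: cvg_cst].
    exact: (cc _ H1).
  by apply: filterS => s; rewrite subrK.
have c : h^-1 *: (f (h *: 1 + t) - f t) @[h --> 0^'] --> d.
  apply/cvgrPdist_le => e e0.
  suff : \forall h \near (0 : R), h != 0 ->
    `|d - h^-1 *: (f (h *: 1 + t) - f t)| <= e by [].
  have := H e e0 => H0.
  have H1 : \forall h \near 0, `|f (h + t) - f t - d * (h + t - t)| <= e * `|h + t - t|.
    have cc : (h + t) @[h --> 0] --> t.
      rewrite -[X in _ --> X]add0r.
      by apply: cvgD; [exact: cvg_id|exact: cvg_cst].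
    exact: (cc _ H0).
  near=> h => h0; rewrite distrC E// ler_pdivrMr ?normr_gt0//.
  have : `|f (h + t) - f t - d * (h + t - t)| <= e * `|h + t - t| by near: h.
  by rewrite addrK.
have dv : derivable f t 1 by apply/cvg_ex; exists d.
by split => //; apply/cvg_lim.
Unshelve. all: by end_near. Qed.

Lemma is_derive1_left f (t d e : R) : is_derive t 1 f d -> 0 < e ->
  \forall s \near t^'-, `|f t - f s - d * (t - s)| <= e * (t - s).
Proof.
move=> /is_derive1P H e0; have {}H := H _ e0.
suff : \forall s \near t, s < t -> `|f t - f s - d * (t - s)| <= e * (t - s) by [].
near=> s => st; have : `|f s - f t - d * (s - t)| <= e * `|s - t| by near: s.
rewrite (distrC s) (ger0_norm (_ : 0 <= t - s)) ?subr_ge0 ?(ltW st)//.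
by apply: le_trans; rewrite -normrN le_eqVlt; apply/orP; left; apply/eqP; congr (`|_|); ring.
Unshelve. all: by end_near. Qed.

Lemma near_dist (t : R) (P : set R) : (\forall s \near t, P s) ->
  exists2 r : R, 0 < r & forall s, `|s - t| < r -> P s.
Proof.
move=> H; have [r /= r0 rP] := (nbhs_ballP t P).1 H.
by exists r => // s st; apply: rP; rewrite /ball/= distrC.
Qed.

Lemma near_right_dist (t : R) (P : set R) : (\forall s \near t^'+, P s) ->
  exists2 r : R, 0 < r & forall s, t < s -> s < t + r -> P s.
Proof.
move=> H; have [r r0 rP] := near_dist (H : nbhs t (fun s => t < s -> P s)).
by exists r => // s ts sr; apply: rP => //; rewrite gtr0_norm; lra.
Qed.

Lemma near_left_lt (t : R) (P : set R) : (\forall s \near t, P s) ->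
  forall a, a < t -> exists s, [/\ a < s, s < t & P s].
Proof.
move=> nP a at_; near (t^'-) => s; exists s; split.
- by near: s; exact: nbhs_left_gt.
- by near: s; exact: nbhs_left_lt.
- by near: s; exact: cvg_at_left_filter nP.
Unshelve. all: by end_near. Qed.

(** The lower left Dini derivative suffices for monotonicity, and it need only
be controlled where [f] exceeds a level [c] lying below its initial value:
the argument takes place at the first time when [f], corrected by a small
linear term, falls to a level between [maxr c (f b)] and [f a]. *)
Lemma left_dini_nondecreasing f (a b c : R) : a <= b -> c < f a ->
  (forall t, a <= t <= b -> {for t, continuous f}) ->
  (forall t e, a < t <= b -> c < f t -> 0 < e ->
     \forall s \near t^'-, f s <= f t + e * (t - s)) ->
  f a <= f b.
Proof.
move=> ab cfa fcont dini; rewrite leNgt; apply/negP => fba.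
have altb : a < b by rewrite lt_neqAle ab andbT; apply/eqP => E; rewrite E ltxx in fba.
pose m0 := Num.max c (f b).
have cm0 : c <= m0 by rewrite /m0 le_max lexx.
have bm0 : f b <= m0 by rewrite /m0 le_max lexx orbT.
have m0a : m0 < f a by rewrite /m0 gt_max cfa fba.
pose e := (f a - m0) / (3 * (b - a)).
have ba0 : 0 < b - a by rewrite subr_gt0.
have e0 : 0 < e by rewrite divr_gt0 ?subr_gt0// mulr_gt0.
have eba : e * (b - a) = (f a - m0) / 3 by rewrite /e; field; rewrite gt_eqF.
pose g t := f t + e * (t - a).
pose m := (f a + m0) / 2.
have gcont t : a <= t <= b -> {for t, continuous g}.
  move=> /fcont ft; apply: continuousD => //.
  apply: continuousM; first exact: cst_continuous.
  by apply: continuousB; [exact: cvg_id|exact: cst_continuous].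
pose S := [set t | a <= t <= b /\ g t <= m].
have Sb : S b by split; [rewrite lexx ab|rewrite /g /m eba; lra].
have lbS : lbound S a by move=> t [/andP[]].
have hS : has_inf S by split; [exists b|exists a].
pose tau := inf S.
have atau : a <= tau by apply: lb_le_inf => //; exists b.
have taub : tau <= b by apply: ge_inf => //; exists a.
have Stau s : s < tau -> a <= s -> m < g s.
  move=> st as_; rewrite ltNge; apply/negP => gs.
  have : tau <= s.
    by apply: ge_inf; [exists a|split => //; rewrite as_ (ltW (lt_le_trans st taub))].
  by rewrite leNgt st.
have gtau : g tau <= m.
  rewrite leNgt; apply/negP => gm.
  have /gcont ct : a <= tau <= b by rewrite atau taub.
  have [r r0 rP] := near_dist (@cvgr_gt _ _ _ _ _ _ ct _ gm).
  have [s Ss sr] := inf_adherent r0 hS.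
  have ts : tau <= s by apply: ge_inf => //; exists a.
  have : m < g s by apply: rP; rewrite ger0_norm ?subr_ge0//; lra.
  by case: Ss => _; rewrite leNgt => /negP.
have ltau : a < tau.
  rewrite lt_neqAle atau andbT; apply/eqP => E; move: gtau.
  by rewrite -E /g subrr mulr0 addr0 /m; lra.
have abt : a <= tau <= b by rewrite atau taub.
have gtau' : m <= g tau.
  rewrite leNgt; apply/negP => gm.
  have [s [as_ st sm]] := near_left_lt (@cvgr_lt _ _ _ _ _ _ (gcont _ abt) _ gm) ltau.
  by move: sm => /=; apply/negP; rewrite -leNgt ltW// Stau// ltW.
have cftau : c < f tau.
  have : e * (tau - a) <= (f a - m0) / 3 by rewrite -eba ler_pM2l// lerD2r.
  by move: gtau'; rewrite /g /m; lra.
have al : a < tau <= b by rewrite ltau taub.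
near (tau^'-) => s.
have H1 : f s <= f tau + e * (tau - s) by near: s; exact: dini.
have H2 : a < s by near: s; exact: nbhs_left_gt.
have H3 : s < tau by near: s; exact: nbhs_left_lt.
have := Stau s H3 (ltW H2); rewrite /g; move: gtau; rewrite /g.
lra.
Unshelve. all: by end_near. Qed.

(** Levine's concavity method in Riccati form: where [0 < q] the hypotheses
read [y' >= q] and [y q' >= p y' ^ 2 >= p q y'], so that
[(y / q)' <= - (p - 1)], and the positive quantity [y / q] would have to
vanish in finite time. *)
Lemma levine_riccati (p t0 : R) y q (dy : R -> R) : 1 < p ->
  (forall t, t0 <= t -> is_derive t 1 y (dy t)) ->
  (forall t, t0 <= t -> {for t, continuous q}) ->
  (forall t, t0 <= t -> 0 <= y t) ->
  (forall t, t0 <= t -> q t <= dy t) ->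
  (forall t, t0 < t -> 0 < q t -> 0 < y t /\
     forall e, 0 < e -> \forall s \near t^'-,
       (p * dy t ^+ 2 - e) * (t - s) <= y t * (q t - q s)) ->
  q t0 <= 0.
Proof.
move=> p1 ydy qc y0 qdy dini; rewrite leNgt; apply/negP => q0.
have qmono t : t0 < t -> 0 < q t -> \forall s \near t^'-, q s <= q t.
  move=> tt qt; have [yt /(_ (p * dy t ^+ 2)) H] := dini t tt qt.
  have dyt : 0 < dy t by rewrite (lt_le_trans qt)// qdy// ltW.
  have {}H := H (mulr_gt0 (lt_trans ltr01 p1) (exprn_gt0 2 dyt)).
  by apply: filterS H => s; rewrite subrr mul0r pmulr_rge0// subr_ge0.
have qpos t : t0 <= t -> 0 < q t.
  move=> tt; apply: (lt_le_trans q0).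
  apply: (@left_dini_nondecreasing q t0 t 0) => //.
    by move=> s /andP[ts _]; exact: qc.
  move=> s e /andP[ts _] qs e0.
  near=> r; have H : q r <= q s by near: r; exact: qmono.
  have rs : r < s by near: r; exact: nbhs_left_lt.
  have : 0 <= e * (s - r) by apply: mulr_ge0; rewrite ?subr_ge0 ltW.
  lra.
(* The affine function [A] vanishes at [T]; [0 < k t] says that [y / q] lies
   below [A] at [t]. *)
pose K := y t0 / q t0 + 1; pose A t := K - (p - 1) * (t - t0).
have K0 : 0 < K by rewrite ltr_wpDl// divr_ge0 ?y0// ltW.
have p10 : 0 < p - 1 by rewrite subr_gt0.
pose T := t0 + K / (p - 1).
have tT : t0 <= T by rewrite lerDl divr_ge0// ltW.
pose k t := A t * q t - y t.
have kt0 : k t0 = q t0.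
  by rewrite /k /A /K subrr mulr0 subr0; field; rewrite gt_eqF.
have kT : k T = - y T.
  have AT : A T = 0 by rewrite /A /T; field; rewrite gt_eqF.
  by rewrite /k AT mul0r sub0r.
suff : k t0 <= k T by rewrite kt0 kT; have := y0 _ tT; lra.
apply: (@left_dini_nondecreasing k t0 T 0) => //; first by rewrite kt0.
  move=> t /andP[tt _]; rewrite /k; apply: continuousB; last first.
    apply: differentiable_continuous; apply/derivable1_diffP.
    by have [] := ydy _ tt.
  apply: continuousM; last exact: qc.
  apply: continuousB; first exact: cst_continuous.
  apply: continuousM; first exact: cst_continuous.
  by apply: continuousB; [exact: cvg_id|exact: cst_continuous].
move=> t e /andP[tt _] kt e0.
have qt := qpos _ (ltW tt); have [yt H] := dini t tt qt.
have dq := qdy _ (ltW tt).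
have e2 : 0 < e / 2 by rewrite divr_gt0.
have {}H := H _ (mulr_gt0 qt e2).
have dy' := is_derive1_left (ydy _ (ltW tt)) e2.
have qm := qmono _ tt qt.
near=> s.
have H1 : (p * dy t ^+ 2 - q t * (e / 2)) * (t - s) <= y t * (q t - q s) by near: s.
have H2 : q s <= q t by near: s.
have H3 : y t - y s <= (dy t + e / 2) * (t - s).
  have : `|y t - y s - dy t * (t - s)| <= e / 2 * (t - s) by near: s.
  by rewrite ler_norml => /andP[_]; lra.
have H4 : s < t by near: s; exact: nbhs_left_lt.
have H5 : k t - k s = A t * (q t - q s) - (p - 1) * (t - s) * q s - (y t - y s).
  by rewrite /k /A; ring.
have H6 : (p * dy t ^+ 2 / q t - e / 2) * (t - s) <= A t * (q t - q s).
  apply: (@le_trans _ _ (y t / q t * (q t - q s))); last first.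
    apply: ler_wpM2r; first by rewrite subr_ge0.
    by rewrite ler_pdivrMr//; move: kt; rewrite /k; lra.
  rewrite -(ler_pM2r qt).
  rewrite [leRHS](_ : _ = y t * (q t - q s)); last by field; rewrite gt_eqF.
  rewrite [leLHS](_ : _ = (p * dy t ^+ 2 - q t * (e / 2)) * (t - s))//.
  by field; rewrite gt_eqF.
have ts0 : 0 < t - s by rewrite subr_gt0.
have H7 : (p - 1) * (t - s) * q s <= (p - 1) * dy t * (t - s).
  rewrite -mulrA -[leRHS]mulrA ler_pM2l// mulrC ler_pM2r//.
  exact: le_trans dq.
have H8 : p * dy t <= p * dy t ^+ 2 / q t.
  rewrite ler_pdivlMr// expr2 mulrA ler_wpM2l// mulr_ge0//; first by lra.
  by lra.
have H9 : p * dy t * (t - s) <= p * dy t ^+ 2 / q t * (t - s) by rewrite ler_pM2r.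
lra.
Unshelve. all: by end_near. Qed.

End Slopes.

(** * Blow-up for abstract gradient flows *)

Section GradientFlow.
Variables (R : realType) (V : lmodType R) (D : set V) (b a : V -> V -> R).
Variables (l : R -> V -> R) (u : R -> V) (u0 : V) (Psi : R -> R).
Variables (Psi0 alpha D1 D2 : R).

Let L t x := l t x - a (u t) x.
Let nrm x := Num.sqrt (b x x).

Hypotheses (alpha2 : 2 < alpha) (D1_ge0 : 0 <= D1).
Hypotheses (sD : subspace D) (bP : psd_on D b) (aP : psd_on D a).
Hypothesis lP : forall t : R, 0 < t -> linear_on D (l t).
Hypotheses (Du : forall t : R, 0 < t -> D (u t)) (Du0 : D u0).
Hypothesis u_derive : forall (x : V) (t : R), D x -> 0 < t ->
  is_derive t 1 (fun s => b (u s) x) (L t x).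
Hypothesis L_bounded : forall t : R, 0 < t -> exists C : R, \forall s \near t,
  forall x, D x -> `|L s x| <= C * nrm x.
Hypothesis a_cont : forall t : R, 0 < t ->
  a (u s - u t) (u s - u t) @[s --> t] --> (0 : R).
Hypothesis Psi_derive : forall t : R, 0 < t -> exists C : R, \forall s \near t,
  `|Psi s - Psi t + l t (u s - u t)| <= C * b (u s - u t) (u s - u t).
Hypothesis Psi_init : Psi t @[t --> 0^'+] --> Psi0.
Hypothesis u_init : b (u t - u0) (u t - u0) @[t --> 0^'+] --> (0 : R).
Hypothesis l_init : l t (u t - u0) @[t --> 0^'+] --> (0 : R).

Let E t := a (u t) (u t) / 2 + Psi t.
Let y t := b (u t) (u t) / 2.

Hypothesis growth : forall t : R, 0 < t ->
  D1 * b (u t) (u t) - alpha * E t - D2 <= L t (u t).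

Let LP (t : R) : 0 < t -> linear_on D (L t).
Proof.
move=> t0 c x z Dx Dz; rewrite /L lP// (psd_linearr sD aP (Du t0))//; ring.
Qed.

Let nrm_ge0 x : 0 <= nrm x. Proof. exact: sqrtr_ge0. Qed.

Let nrmE x : D x -> b x x = nrm x ^+ 2.
Proof. by move=> Dx; rewrite sqr_sqrtr// (psd_ge0 bP). Qed.

(** Testing with the increment of [u] itself turns the bound on [L] into a
Lipschitz bound. *)
Lemma flow_lipschitz (t : R) : 0 < t -> exists2 C : R, 0 <= C & \forall s \near t,
  [/\ 0 < s, nrm (u t - u s) <= C * `|t - s| & forall x, D x -> `|L s x| <= C * nrm x].
Proof.
move=> t0; have [C0 HC] := L_bounded t0.
have nC : \forall s \near t, 0 < s /\ forall x, D x -> `|L s x| <= `|C0| * nrm x.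
  near=> s; split; first by near: s; exact: lt_nbhsr.
  move=> x Dx; apply: le_trans (_ : C0 * nrm x <= _); last first.
    by rewrite ler_wpM2r// ler_norm.
  by move: x Dx; near: s.
have [r r0 rP] := near_dist nC.
have H s1 s2 : s1 <= s2 -> `|s1 - t| < r -> `|s2 - t| < r ->
    nrm (u s2 - u s1) <= `|C0| * (s2 - s1).
  move=> s12 s1r s2r; set x := u s2 - u s1.
  have Dx : D x by apply: subspaceB => //; apply: Du; apply: (rP _ _).1.
  have cr c : c \in `[s1, s2]%R -> `|c - t| < r.
    rewrite in_itv/= => /andP[c1 c2]; move: s1r s2r.
    by rewrite !ltr_norml => /andP[? ?] /andP[? ?]; apply/andP; split; lra.
  have dx c : c \in `[s1, s2]%R -> is_derive c 1 (fun s => b (u s) x) (L c x).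
    by move=> /cr /rP[c0 _]; exact: u_derive.
  have cf : {within `[s1, s2], continuous (fun s => b (u s) x)}.
    by apply: derivable_within_continuous => c /dx[].
  have dx' c : c \in `]s1, s2[%R -> is_derive c 1 (fun s => b (u s) x) (L c x).
    by move=> cs; apply: dx; exact: subset_itv_oo_cc cs.
  have [c] := MVT_segment s12 dx' cf.
  move=> /cr /rP[c0 /(_ x Dx) Lc].
  rewrite -(linear_onB (psd_linearl bP Dx)); try by apply: Du; apply: (rP _ _).1.
  rewrite -/x nrmE// => nE.
  have : nrm x ^+ 2 <= nrm x * (`|C0| * (s2 - s1)).
    rewrite nE mulrCA mulrA; apply: ler_wpM2r; first by rewrite subr_ge0.
    exact: le_trans (ler_norm _) Lc.
  have [->|n0] := eqVneq (nrm x) 0; first by rewrite mulr_ge0 ?subr_ge0.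
  by rewrite expr2 ler_pM2l// lt_neqAle eq_sym n0 nrm_ge0.
exists `|C0| => //; near=> s.
have [s0 sL] : 0 < s /\ forall x, D x -> `|L s x| <= `|C0| * nrm x by near: s.
split => //.
have sr : `|s - t| < r.
  by rewrite distrC; near: s; apply: cvgr_dist_lt => //; exact: cvg_id.
have tr : `|t - t| < r by rewrite subrr normr0.
have [st|ts] := leP s t.
  by rewrite (ger0_norm (_ : 0 <= t - s)) ?subr_ge0// H.
have Nn x : D x -> nrm (- x) = nrm x.
  move=> Dx; rewrite /nrm -(addr0 (- x)) -scaleN1r.
  have D0 : D 0 by rewrite -(subrr x); exact: subspaceB.
  rewrite (psd_expand sD bP)//.
  have b0 z : D z -> b z 0 = 0.
    by move=> Dz; rewrite -(subrr x) (linear_onB (psd_linearr sD bP Dz))// subrr.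
  by rewrite !b0// -{1}(addr0 x); congr Num.sqrt; rewrite !addr0 mulr0 addr0 expr2 mulrNN !mul1r.
rewrite -opprB Nn; last by apply: subspaceB => //; exact: Du.
by rewrite distrC (gtr0_norm (_ : 0 < s - t)) ?subr_gt0// H// ltW.
Unshelve. all: by end_near. Qed.

(** [y] differs from [b (u s) (u t)] by a constant and by half the square of the
increment of [u], which is quadratically small by [flow_lipschitz]. *)
Lemma flow_norm_derive (t : R) : 0 < t -> is_derive t 1 y (L t (u t)).
Proof.
move=> t0; have [C C0 HC] := flow_lipschitz t0.
have du := (is_derive1P _ _ _).1 (u_derive (Du t0) t0).
apply/is_derive1P => e e0.
have e2 : 0 < e / 2 by rewrite divr_gt0.
have {}du := du _ e2.
pose d := (e / 2) / (C ^+ 2 + 1).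
have d0 : 0 < d by rewrite divr_gt0// ltr_wpDl// sqr_ge0.
near=> s.
have [s0 sC _] : [/\ 0 < s, nrm (u t - u s) <= C * `|t - s| &
  forall x, D x -> `|L s x| <= C * nrm x] by near: s.
have H1 : `|b (u s) (u t) - b (u t) (u t) - L t (u t) * (s - t)| <= e / 2 * `|s - t|.
  by near: s.
have H2 : `|t - s| <= d by near: s; apply: cvgr_dist_le => //; exact: cvg_id.
have [Ds Dt] := (Du s0, Du t0).
have H3 : b (u t - u s) (u t - u s) <= e / 2 * `|s - t|.
  rewrite nrmE; last exact: subspaceB.
  apply: le_trans (_ : (C * `|t - s|) ^+ 2 <= _); first by rewrite ler_sqr ?nnegrE// mulr_ge0.
  rewrite exprMn [`|t - s| ^+ 2]expr2 mulrA (distrC s) ler_wpM2r//.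
  apply: le_trans (_ : (C ^+ 2 + 1) * d <= _).
    by rewrite ler_pM// ?sqr_ge0// lerDl.
  by rewrite /d mulrC divfK// gt_eqF// ltr_wpDl// sqr_ge0.
move: H3; rewrite (psd_expandB sD bP)// (psdC bP Dt Ds) => H3.
have H4 : 0 <= b (u t) (u t) - 2 * b (u s) (u t) + b (u s) (u s).
  have := psd_ge0 bP (subspaceB sD Dt Ds).
  by rewrite (psd_expandB sD bP)// (psdC bP Dt Ds).
move: H1; rewrite !ler_norml /y => /andP[H1 H5]; apply/andP; split; lra.
Unshelve. all: by end_near. Qed.

Lemma flow_energy_cont (t : R) : 0 < t -> {for t, continuous E}.
Proof.
move=> t0; have [C C0 HC] := flow_lipschitz t0; have Dt := Du t0.
have nb : b (u s - u t) (u s - u t) @[s --> t] --> (0 : R).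
  have cC : (C * `|t - s|) ^+ 2 @[s --> t] --> (0 : R).
    have -> : (0 : R) = (C * `|t - t|) ^+ 2 by rewrite subrr normr0 mulr0 expr0n.
    rewrite expr2; under eq_fun do rewrite expr2.
    have : C * `|t - s| @[s --> t] --> C * `|t - t|.
      apply: cvgM; first exact: cvg_cst.
      by apply: cvg_norm; apply: cvgB; [exact: cvg_cst|exact: cvg_id].
    by move=> h; exact: cvgM.
  apply: (squeeze_cvgr _ (cvg_cst 0) cC); near=> s.
  have [s0 H _] : [/\ 0 < s, nrm (u t - u s) <= C * `|t - s| &
    forall x, D x -> `|L s x| <= C * nrm x] by near: s.
  have Ds := Du s0; have Dd := subspaceB sD Dt Ds.
  rewrite (psd_ge0 bP (subspaceB sD Ds Dt))/=.
  rewrite (_ : b _ _ = b (u t - u s) (u t - u s)).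
    by rewrite nrmE// ler_sqr ?nnegrE// mulr_ge0.
  by rewrite !(psd_expandB sD bP)// (psdC bP Dt Ds); ring.
have Lc : L t (u s - u t) @[s --> t] --> (0 : R).
  have cC : C * nrm (u s - u t) @[s --> t] --> (0 : R).
    rewrite -(mulr0 C); apply: cvgM; first exact: cvg_cst.
    rewrite -[X in _ --> X]sqrtr0; exact: (continuous_cvg _ (@sqrt_continuous R 0) nb).
  have cN : - (C * nrm (u s - u t)) @[s --> t] --> (0 : R).
    by rewrite -oppr0; exact: cvgN.
  apply: (squeeze_cvgr _ cN cC); near=> s.
  have [s0 _ _] : [/\ 0 < s, nrm (u t - u s) <= C * `|t - s| &
    forall x, D x -> `|L s x| <= C * nrm x] by near: s.
  have [_ _ H] := nbhs_singleton HC.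
  by rewrite -ler_norml H//; apply: subspaceB => //; exact: Du.
have [CP HP] := Psi_derive t0.
have Ps : Psi s - Psi t + l t (u s - u t) @[s --> t] --> (0 : R).
  have cC : CP * b (u s - u t) (u s - u t) @[s --> t] --> (0 : R).
    by rewrite -(mulr0 CP); apply: cvgM => //; exact: cvg_cst.
  have cN : - (CP * b (u s - u t) (u s - u t)) @[s --> t] --> (0 : R).
    by rewrite -oppr0; exact: cvgN.
  apply: (squeeze_cvgr _ cN cC); near=> s.
  by rewrite -ler_norml; near: s.
have : (a (u s - u t) (u s - u t) / 2 +
  (Psi s - Psi t + l t (u s - u t)) - L t (u s - u t)) + E t @[s --> t] -->
  (0 / 2 + 0 - 0) + E t.
  apply: cvgD; last exact: cvg_cst.
  apply: cvgB => //; apply: cvgD => //.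
  by apply: cvgM; [exact: a_cont|exact: cvg_cst].
rewrite mul0r addr0 subr0 add0r => H.
apply: cvg_trans H; apply: near_eq_cvg; near=> s.
have [s0 _ _] : [/\ 0 < s, nrm (u t - u s) <= C * `|t - s| &
  forall x, D x -> `|L s x| <= C * nrm x] by near: s.
have Ds := Du s0.
rewrite /E /L (psd_expandB sD aP)// (linear_onB (psd_linearr sD aP Dt))//.
by rewrite (psdC aP Ds Dt); field.
Unshelve. all: by end_near. Qed.

(** The backward difference quotients of [u] at [t] converge weakly to the
vector representing [L t], and the form [a] is convex; together these give
[- E' >= |L t| ^ 2 >= (L t (u t)) ^ 2 / |u t| ^ 2] from the left. *)
Lemma flow_dissipation (t e : R) : 0 < t -> 0 < e -> \forall s \near t^'-,
  (L t (u t) ^+ 2 - e) * (t - s) <= b (u t) (u t) * (E s - E t).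
Proof.
move=> t0 e0; have [C C0 HC] := flow_lipschitz t0.
have [CP HP] := Psi_derive t0; have Dt := Du t0.
have [_ _ Lt] := nbhs_singleton HC.
pose B := b (u t) (u t).
have B0 : 0 <= B := psd_ge0 bP Dt.
(* All errors below are multiples of [k]; together they stay within
   [k * B * (4 * C + 6)], which is at most [e]. *)
pose K := B * (4 * C + 6) + 1.
have K0 : 0 < K by rewrite ltr_wpDl// mulr_ge0// addr_ge0// mulr_ge0.
pose k := Num.min 1 (e / K).
have k0 : 0 < k by rewrite lt_min ltr01 divr_gt0.
have k1 : k <= 1 by rewrite ge_min lexx.
have kK : k * K <= e by rewrite -ler_pdivlMr// ge_min lexx orbT.
have D0 : D !=set0 by exists (u t).
have [x Dx xL] := approximate_riesz sD bP D0 (LP t0) Lt k0.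
have dx := is_derive1_left (u_derive Dx t0) k0.
have c1 : 0 < `|CP| * C ^+ 2 + 1 by rewrite ltr_wpDl// mulr_ge0// sqr_ge0.
near=> s.
have [s0 sC _] : [/\ 0 < s, nrm (u t - u s) <= C * `|t - s| &
  forall x, D x -> `|L s x| <= C * nrm x].
  by near: s; exact: cvg_at_left_filter HC.
have Ps : `|Psi s - Psi t + l t (u s - u t)| <= CP * b (u s - u t) (u s - u t).
  by near: s; exact: cvg_at_left_filter HP.
have bx : `|b (u t) x - b (u s) x - L t x * (t - s)| <= k * (t - s) by near: s.
have st : s < t by near: s; exact: nbhs_left_lt.
have hs : t - s < k / (`|CP| * C ^+ 2 + 1).
  by near: s; apply: nbhs_left_ltBl; rewrite divr_gt0.
have Ds := Du s0; have Dd := subspaceB sD Dt Ds.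
pose h := t - s; have h0 : 0 < h by rewrite subr_gt0.
have {}sC : nrm (u t - u s) <= C * h by rewrite -(gtr0_norm h0).
pose n := nrm x; have n0 : 0 <= n := nrm_ge0 x.
have Lx : n ^+ 2 - k * n <= L t x.
  by have := xL _ Dx; rewrite -/(nrm x) (nrmE Dx) -/n ler_norml => /andP[]; lra.
have nC : n <= C + k.
  have := Lt _ Dx; rewrite -/n => /(le_trans (ler_norm _)) LC.
  have [->|nn0] := eqVneq n 0; first by rewrite addr_ge0// ltW.
  have np : 0 < n by rewrite lt_neqAle eq_sym nn0 n0.
  rewrite -(ler_pM2l np); move: Lx; rewrite expr2; lra.
have Ld : b (u t - u s) x - k * (C * h) <= L t (u t - u s).
  have := xL _ Dd; rewrite ler_norml => /andP[H _].
  have : k * nrm (u t - u s) <= k * (C * h) by rewrite ler_pM2l.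
  by rewrite (psdC bP Dd Dx); move: H; rewrite -/(nrm _); lra.
have bd : h * L t x - k * h <= b (u t - u s) x.
  rewrite (linear_onB (psd_linearl bP Dx))//.
  by move: bx; rewrite ler_norml -/h => /andP[]; lra.
have Pe : CP * b (u s - u t) (u s - u t) <= k * h.
  have -> : b (u s - u t) (u s - u t) = nrm (u t - u s) ^+ 2.
    rewrite -nrmE// !(psd_expandB sD bP)// (psdC bP Dt Ds); ring.
  have H1 : CP * nrm (u t - u s) ^+ 2 <= `|CP| * nrm (u t - u s) ^+ 2.
    by rewrite ler_wpM2r ?sqr_ge0// ler_norm.
  have H2 : `|CP| * nrm (u t - u s) ^+ 2 <= `|CP| * (C * h) ^+ 2.
    by rewrite ler_wpM2l// ler_sqr ?nnegrE// mulr_ge0// ltW.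
  have H3 : h * (`|CP| * C ^+ 2 + 1) <= k by rewrite -ler_pdivlMr// ltW.
  have H4 : h * (`|CP| * C ^+ 2 + 1) * h <= k * h by rewrite ler_pM2r.
  have H5 : 0 <= h * h by rewrite mulr_ge0 ?ltW.
  have H6 : `|CP| * (C * h) ^+ 2 = `|CP| * C ^+ 2 * (h * h) by ring.
  have H7 : h * (`|CP| * C ^+ 2 + 1) * h = `|CP| * C ^+ 2 * (h * h) + h * h by ring.
  lra.
(* The increment of [E] falls short of its linear part only by the error of
   [Psi], since [a] is convex. *)
have EE : L t (u t - u s) - k * h <= E s - E t.
  have := psd_ge0 aP Dd; rewrite (psd_expandB sD aP)// => aa.
  have LE : L t (u t - u s) =
      - l t (u s - u t) - (a (u t) (u t) - a (u t) (u s)).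
    rewrite /L (linear_onB (psd_linearr sD aP Dt))//.
    by rewrite !(linear_onB (lP t0))//; ring.
  have : - (k * h) <= Psi s - Psi t + l t (u s - u t).
    by move: Ps; rewrite ler_norml => /andP[]; lra.
  by rewrite LE /E; lra.
have nn : n ^+ 2 - k * (C + 1) <= L t x.
  have : k * n <= k * (C + 1) by rewrite ler_pM2l//; lra.
  lra.
have Ek : h * (n ^+ 2 - k * (2 * C + 3)) <= E s - E t.
  have H1 : h * (n ^+ 2 - k * (C + 1)) <= h * L t x by rewrite ler_pM2l.
  have H2 : h * (n ^+ 2 - k * (2 * C + 3)) =
    h * (n ^+ 2 - k * (C + 1)) - k * h - k * (C * h) - k * h by ring.
  lra.
have Lu : L t (u t) ^+ 2 <= (n ^+ 2 + k * (2 * C + 3)) * B.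
  have : `|L t (u t)| <= (n + k) * nrm (u t).
    have := xL _ Dt; have := psd_CS_sqrt sD bP Dx Dt.
    rewrite -/(nrm x) -/(nrm (u t)) -/n => cs xl.
    rewrite mulrDl; apply: le_trans (lerD cs xl).
    by rewrite -[in leLHS](subrK (b x (u t)) (L t (u t))) addrC ler_normD.
  rewrite -(@ler_sqr R) ?nnegrE// ?mulr_ge0 ?addr_ge0 ?(ltW k0)//.
  rewrite real_normK ?num_real// exprMn -nrmE// -/B => Lle.
  apply: (le_trans Lle); rewrite ler_wpM2r//.
  have -> : (n + k) ^+ 2 = n ^+ 2 + k * (2 * n + k) by ring.
  by rewrite lerD2l ler_pM2l//; lra.
apply: (@le_trans _ _ (h * (n ^+ 2 - k * (2 * C + 3)) * B)); last first.
  by rewrite mulrC ler_wpM2l.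
rewrite -/h mulrC -mulrA ler_pM2l//.
have : k * (B * (4 * C + 6)) <= e.
  by apply: le_trans kK; rewrite ler_pM2l// /K lerDl.
lra.
Unshelve. all: by end_near. Qed.

(** Testing with [u - u0] bounds the mean of [a (u t) (u t)] over short
intervals by [a u0 u0], so the form of the solution cannot jump upwards at
time zero even though [u] is only [b]-continuous there. *)
Lemma flow_initial_form (e r : R) : 0 < e -> 0 < r ->
  exists t : R, [/\ 0 < t, t < r & a (u t) (u t) <= a u0 u0 + e].
Proof.
move=> e0 r0; apply: contrapT => no.
have big (t : R) : 0 < t -> t < r -> a u0 u0 + e < a (u t) (u t).
  by move=> t0 tr; rewrite ltNge; apply/negP => le; apply: no; exists t.
pose z t := b (u t - u0) (u t - u0) / 2.
have zE (t : R) : 0 < t -> z t = y t - b (u t) u0 + b u0 u0 / 2.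
  move=> t0; rewrite /z /y (psd_expandB sD bP)//; last exact: Du.
  by field.
pose z' t := y t - b (u t) u0.
have dz (t : R) : 0 < t -> is_derive t 1 z' (L t (u t) - L t u0).
  by move=> t0; apply: is_deriveB; [exact: flow_norm_derive|exact: u_derive].
have l4 : \forall t \near 0^'+, l t (u t - u0) < e / 4.
  by apply: (cvgr_lt (0 : R)) => //; rewrite divr_gt0.
have [r1 r10 r1P] : exists2 r1 : R, 0 < r1 & forall t : R, 0 < t -> t < r1 -> l t (u t - u0) < e / 4.
  have [r1 r10 r1P] := near_right_dist l4.
  by exists r1 => // t t0 tr; apply: r1P => //; rewrite add0r.
pose r2 := Num.min r r1.
have r20 : 0 < r2 by rewrite lt_min r0 r10.
have L4 (t : R) : 0 < t -> t < r2 -> L t (u t) - L t u0 <= - (e / 4).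
  move=> t0; rewrite lt_min => /andP[tr tr1].
  have := r1P t t0 tr1; have := big t t0 tr.
  have Dt := Du t0; have := psd_ge0 aP (subspaceB sD Dt Du0).
  rewrite (psd_expandB sD aP)// -(linear_onB (LP t0))// /L.
  by rewrite (linear_onB (psd_linearr sD aP Dt))//; lra.
have zdec (s t : R) : 0 < s -> s < t -> t < r2 -> z t < z s.
  move=> s0 st tr; have t0 := lt_trans s0 st.
  have cf : {within `[s, t], continuous z'}.
    apply: derivable_within_continuous => c; rewrite in_itv/= => /andP[sc _].
    by have [] := dz c (lt_le_trans s0 sc).
  have dz' c : c \in `]s, t[%R -> is_derive c 1 z' (L c (u c) - L c u0).
    by rewrite in_itv/= => /andP[sc _]; apply: dz; exact: lt_trans sc.
  have [c] := MVT st dz' cf.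
  rewrite in_itv/= => /andP[sc ct] zst.
  have := L4 c (lt_trans s0 sc) (lt_trans ct tr).
  have ts : 0 < t - s by rewrite subr_gt0.
  rewrite -(ler_pM2r ts) -zst /z' => H.
  have : 0 < e / 4 * (t - s) by rewrite mulr_gt0// divr_gt0.
  by rewrite !zE//; lra.
pose t1 := r2 / 4; pose t2 := r2 / 2.
have zt1 : 0 < z t1.
  apply: le_lt_trans (zdec t1 t2 _ _ _); rewrite /t1 /t2; try lra.
  by rewrite /z divr_ge0// (psd_ge0 bP)//; apply: subspaceB => //; apply: Du; lra.
have : \forall t \near 0^'+, z t < z t1.
  have : z t @[t --> 0^'+] --> (0 : R).
    by rewrite -[X in _ --> X](mul0r (2^-1)); apply: cvgM => //; exact: cvg_cst.
  by move=> /cvgr_lt; exact.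
move=> near1; near (0 : R)^'+ => s.
have : z s < z t1 by near: s.
apply/negP; rewrite -leNgt ltW// zdec//; last by rewrite /t1; lra.
near: s; apply: nbhs_right_lt; rewrite /t1; lra.
Unshelve. all: by end_near. Qed.

(** The blow-up criterion in contrapositive form: the flow exists at all
positive times, so its initial datum cannot have large norm and low energy. *)
Theorem flow_no_blow_up_bound :
  D1 * b u0 u0 <= alpha * (a u0 u0 / 2 + Psi0) + D2.
Proof.
rewrite leNgt; apply/negP => H.
have alpha0 : 0 < alpha by apply: lt_trans alpha2.
pose q t := D1 * b (u t) (u t) - alpha * E t - D2.
pose g := D1 * b u0 u0 - alpha * (a u0 u0 / 2 + Psi0) - D2.
have g0 : 0 < g by rewrite /g; lra.
have bu0 : b (u t - u0) u0 @[t --> 0^'+] --> (0 : R).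
  have c : nrm (u t - u0) * nrm u0 @[t --> 0^'+] --> (0 : R).
    rewrite -[X in _ --> X](mul0r (nrm u0)); apply: cvgM; last exact: cvg_cst.
    rewrite -[X in _ --> X]sqrtr0.
    by apply: continuous_cvg u_init; exact: sqrt_continuous.
  have cN : - (nrm (u t - u0) * nrm u0) @[t --> 0^'+] --> (0 : R).
    by rewrite -[X in _ --> X]oppr0; exact: cvgN.
  apply: (squeeze_cvgr _ cN c); near=> t; rewrite -ler_norml.
  apply: (psd_CS_sqrt sD bP) => //; apply: subspaceB => //; apply: Du.
  by near: t; exact: nbhs_right_gt.
have Q : D1 * (b (u t - u0) (u t - u0) + 2 * b (u t - u0) u0) - alpha * (Psi t - Psi0)
    @[t --> 0^'+] --> (0 : R).
  rewrite [X in _ --> X](_ : 0 = D1 * (0 + 2 * 0) - alpha * (Psi0 - Psi0)); last by ring.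
  apply: cvgB; apply: cvgM; try exact: cvg_cst.
    by apply: cvgD; [exact: u_init|apply: cvgM; [exact: cvg_cst|exact: bu0]].
  by apply: cvgB; [exact: Psi_init|exact: cvg_cst].
have [r r0 rP] : exists2 r : R, 0 < r & forall t : R, 0 < t -> t < r ->
    - (g / 2) < D1 * (b (u t - u0) (u t - u0) + 2 * b (u t - u0) u0) - alpha * (Psi t - Psi0).
  have ng : - (g / 2) < 0 by rewrite oppr_lt0 divr_gt0.
  have [r r0 rP] := near_right_dist (cvgr_gt _ Q _ ng).
  by exists r => // t t0 tr; apply: rP => //; rewrite add0r.
have [t0 [t00 t0r at0]] := flow_initial_form (divr_gt0 g0 alpha0) r0.
have q0 : 0 < q t0.
  have := rP t0 t00 t0r; rewrite /q /E.
  rewrite (psd_expandB sD bP)// ?(linear_onB (psd_linearl bP Du0))//; try exact: Du.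
  have : alpha * a (u t0) (u t0) <= alpha * a u0 u0 + g.
    apply: (@le_trans _ _ (alpha * (a u0 u0 + g / alpha))); first by rewrite ler_pM2l.
    by rewrite mulrDr mulrCA divff ?mulr1// gt_eqF.
  by rewrite /g; lra.
have pos (t : R) : t0 <= t -> 0 < t by exact: lt_le_trans.
move: q0; apply/negP; rewrite -leNgt.
apply: (@levine_riccati R (alpha / 2) t0 y q (fun t => L t (u t))).
- by rewrite ltr_pdivlMr// mul1r.
- by move=> t /pos; exact: flow_norm_derive.
- move=> t /pos tp; apply: continuousB; last exact: cst_continuous.
  apply: continuousB; apply: continuousM; try exact: cst_continuous.
    rewrite (_ : (fun t => b (u t) (u t)) = (fun t => 2 * y t)).
      apply: continuousM; first exact: cst_continuous.
      apply: differentiable_continuous; apply/derivable1_diffP.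
      by have [] := flow_norm_derive tp.
    by apply/funext => s; rewrite /y; field.
  exact: flow_energy_cont.
- by move=> t /pos tp; rewrite /y divr_ge0// (psd_ge0 bP)//; exact: Du.
- by move=> t /pos tp; exact: growth.
move=> t /ltW/pos tp qt; have Dt := Du tp.
have Lpos : 0 < L t (u t) by apply: lt_le_trans qt _; exact: growth.
have yt : 0 < y t.
  rewrite /y divr_gt0// lt_neqAle (psd_ge0 bP Dt) andbT; apply/eqP => b0.
  have [C _ HC] := flow_lipschitz tp.
  have [_ _ /(_ _ Dt)] := nbhs_singleton HC.
  by rewrite /nrm -b0 sqrtr0 mulr0 normr_le0 gt_eqF.
split => // e e0.
have e'0 : 0 < 2 * e / alpha by rewrite divr_gt0// mulr_gt0.
have dis := flow_dissipation tp e'0.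
have dy := is_derive1_left (flow_norm_derive tp) Lpos.
near=> s.
have H1 : (L t (u t) ^+ 2 - 2 * e / alpha) * (t - s) <= b (u t) (u t) * (E s - E t).
  by near: s.
have H2 : 0 <= y t - y s.
  have : `|y t - y s - L t (u t) * (t - s)| <= L t (u t) * (t - s) by near: s.
  by rewrite ler_norml => /andP[]; lra.
have H3 : q t - q s = 2 * D1 * (y t - y s) + alpha * (E s - E t).
  by rewrite /q /y; field.
have H4 : 0 <= y t * (2 * D1 * (y t - y s)) 
  by apply: (mulr_ge0 (ltW yt)); apply: mulr_ge0 => //; apply: mulr_ge0.
rewrite H3 (mulrDr (y t)); apply: (@le_trans _ _ (y t * (alpha * (E s - E t)))); last by rewrite lerDr.
rewrite [leLHS](_ : _ = alpha / 2 * ((L t (u t) ^+ 2 - 2 * e / alpha) * (t - s))); last first.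
  by field; rewrite gt_eqF.
rewrite [leRHS](_ : _ = alpha / 2 * (b (u t) (u t) * (E s - E t))); last by rewrite /y; field.
by rewrite ler_pM2l// divr_gt0.
Unshelve. all: by end_near. Qed.

End GradientFlow.

(** * Integration *)

Section Integration.
Import HBNNSimple.
Context d (T : measurableType d) (R : realType).
Variable mu : {measure set T -> \bar R}.
Implicit Types (D : set T).

Lemma ae_impl (P Q : T -> Prop) : (forall x, P x -> Q x) ->
  {ae mu, forall x, P x} -> {ae mu, forall x, Q x}.
Proof. by move=> PQ; apply: filterS. Qed.

Lemma ae_impl2 (P P' Q : T -> Prop) : (forall x, P x -> P' x -> Q x) ->
  {ae mu, forall x, P x} -> {ae mu, forall x, P' x} -> {ae mu, forall x, Q x}.
Proof. by move=> PQ; apply: filterS2. Qed.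

Lemma le_integral_ae_eq0 (f g : T -> \bar R) :
  (forall x, (0 <= f x)%E) -> (forall x, (0 <= g x)%E) ->
  {ae mu, forall x, f x = g x} ->
  (\int[mu]_x f x <= \int[mu]_x g x)%E.
Proof.
move=> f0 g0 [M [mM M0 Mfg]]; rewrite !ge0_integralTE//.
apply: ge_ereal_sup => _ [s /= sf <-].
have mMC : measurable (~` M) by exact: measurableC.
pose s' := mul_nnsfun s (indic_nnsfun R mMC).
have -> : sintegral mu s = sintegral mu s'.
  rewrite -!integralT_nnsfun; apply: ae_eq_integral => //.
  - by apply/measurable_EFinP.
  - by apply/measurable_EFinP.
  exists M; split => // x /= h; apply: contrapT => nM; apply: h => _.
  by rewrite /s' /= mindicE mem_set ?mulr1.
apply: ereal_sup_ubound; exists s' => // x /=; rewrite mindicE.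
have [xM|xM] := pselect (M x).
  by rewrite memNset ?mulr0//; apply.
rewrite mem_set ?mulr1//.
by rewrite -(_ : f x = g x)//; apply: contrapT => fg; apply: xM; apply: Mfg.
Qed.

(** The Lebesgue integral is a supremum over simple functions below the
integrand, so it ignores null sets even when the integrand is not measurable. *)
Lemma integral_congr_ae D (f g : T -> \bar R) :
  {ae mu, forall x, D x -> f x = g x} ->
  (\int[mu]_(x in D) f x = \int[mu]_(x in D) g x)%E.
Proof.
move=> fg; rewrite integral_mkcond [RHS]integral_mkcond.
have {}fg : {ae mu, forall x, (f \_ D) x = (g \_ D) x}.
  apply: filterS fg => x; rewrite !patchE; case: ifPn => //.
  by rewrite inE => Dx; apply.
rewrite integralE [RHS]integralE.
have P : {ae mu, forall x, (f \_ D)^\+%E x = (g \_ D)^\+%E x}.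
  by apply: filterS fg => x; rewrite !funeposE => ->.
have N : {ae mu, forall x, (f \_ D)^\-%E x = (g \_ D)^\-%E x}.
  by apply: filterS fg => x; rewrite !funenegE => ->.
congr (_ - _)%E; apply/eqP; rewrite eq_le !le_integral_ae_eq0//.
- by apply: filterS P.
- by apply: filterS N.
Qed.

Lemma Rintegral_congr_ae D (f g : T -> R) :
  {ae mu, forall x, D x -> f x = g x} ->
  \int[mu]_(x in D) f x = \int[mu]_(x in D) g x.
Proof.
move=> fg; congr fine; apply: integral_congr_ae.
by apply: filterS fg => x h Dx; rewrite h.
Qed.

Lemma cst_integrable D (c : R) : measurable D -> (mu D < +oo)%E ->
  mu.-integrable D (EFin \o cst c).
Proof.
move=> mD fD; apply/integrableP; split; first exact/measurable_EFinP.
rewrite (eq_integral (cst (`|c|%R)%:E))// integral_cst//.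
by rewrite ltey_eq/= fin_numM// ge0_fin_numE.
Qed.

Lemma ae_le_normr_Rintegral D (f g : T -> R) : measurable D ->
  measurable_fun D f -> mu.-integrable D (EFin \o g) ->
  (forall x, D x -> 0 <= g x) ->
  {ae mu, forall x, D x -> `|f x| <= g x} ->
  mu.-integrable D (EFin \o f) /\
  `|\int[mu]_(x in D) f x| <= \int[mu]_(x in D) g x.
Proof.
move=> mD mf ig g0 fg.
have mg : measurable_fun D g.
  by apply/measurable_EFinP; exact: (measurable_int mu).
have mnf : measurable_fun D (fun x => (`|f x|%R)%:E).
  by apply/measurable_EFinP; exact: measurableT_comp.
have le : (\int[mu]_(x in D) (`|f x|%R)%:E <= \int[mu]_(x in D) (g x)%:E)%E.
  by apply: ae_ge0_le_integral => //; exact/measurable_EFinP.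
have if_ : mu.-integrable D (EFin \o f).
  apply/integrableP; split; first exact/measurable_EFinP.
  by apply: le_lt_trans le _; exact: integrable_lty.
split => //; apply: (le_trans (le_normr_Rintegral mD if_)).
rewrite /Rintegral fine_le//.
- by apply: integrable_fin_num => //; exact: integrable_norm.
- exact: integrable_fin_num.
Qed.

(** ** Square-integrable functions *)

Definition square_integrable D (f : T -> R) : Prop :=
  measurable_fun D f /\ mu.-integrable D (EFin \o (fun x => f x ^+ 2)).

Lemma square_integrableP D (f : T -> R) : measurable D -> measurable_fun D f ->
  (\int[mu]_(x in D) (f x ^+ 2)%:E < +oo)%E -> square_integrable D f.
Proof.
move=> mD mf fi; split => //; apply/integrableP; split.
  by apply/measurable_EFinP; exact: measurable_funX.
by under eq_integral => x _ do rewrite /= ger0_norm ?sqr_ge0//.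
Qed.

Lemma square_integrable_lin D (c : R) (f g : T -> R) : measurable D ->
  square_integrable D f -> square_integrable D g ->
  square_integrable D (fun x => c * f x + g x).
Proof.
move=> mD [mf f2] [mg g2].
have mh : measurable_fun D (fun x => c * f x + g x).
  by apply: measurable_funD => //; exact: measurable_funM.
split => //.
have i1 : mu.-integrable D (EFin \o (fun x => 2 * c ^+ 2 * f x ^+ 2 + 2 * g x ^+ 2)).
  have := integrableD mD (integrableZl mD (2 * c ^+ 2) f2) (integrableZl mD 2 g2).
  by apply: eq_integrable => // x _.
apply: le_integrable i1 => //.
  by apply/measurable_EFinP; exact: measurable_funX.
move=> x _ /=; rewrite lee_fin ger0_norm ?sqr_ge0// ger0_norm; last first.
  by apply: addr_ge0; repeat (exact: sqr_ge0 || exact: ler0n || apply: mulr_ge0).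
rewrite -subr_ge0 [X in 0 <= X](_ : _ = (c * f x - g x) ^+ 2) ?sqr_ge0//.
by ring.
Qed.

Lemma square_integrable_bounded D (M : R) (h f : T -> R) : measurable D ->
  measurable_fun D h -> (forall x, D x -> `|h x| <= M) ->
  square_integrable D f -> square_integrable D (fun x => h x * f x).
Proof.
move=> mD mh hM [mf f2].
have mhf : measurable_fun D (fun x => h x * f x) by exact: measurable_funM.
split => //.
have i1 : mu.-integrable D (EFin \o (fun x => M ^+ 2 * f x ^+ 2)).
  by have := integrableZl mD (M ^+ 2) f2; apply: eq_integrable.
apply: le_integrable i1 => //.
  by apply/measurable_EFinP; exact: measurable_funX.
move=> x Dx /=; rewrite lee_fin ger0_norm ?sqr_ge0//.
rewrite (ger0_norm (mulr_ge0 (sqr_ge0 _) (sqr_ge0 _))).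
rewrite exprMn ler_wpM2r ?sqr_ge0// -[leLHS]real_normK ?num_real//.
by rewrite lerXn2r ?nnegrE// ?hM// (le_trans _ (hM x Dx)).
Qed.

Lemma square_integrable_mul D (f g : T -> R) : measurable D ->
  square_integrable D f -> square_integrable D g ->
  mu.-integrable D (EFin \o (fun x => f x * g x)).
Proof.
move=> mD [mf f2] [mg g2].
have i1 : mu.-integrable D (EFin \o (fun x => f x ^+ 2 + g x ^+ 2)).
  by have := integrableD mD f2 g2; apply: eq_integrable.
apply: le_integrable i1 => //.
  by apply/measurable_EFinP; exact: measurable_funM.
move=> x _ /=; rewrite lee_fin [leRHS]ger0_norm ?addr_ge0 ?sqr_ge0//.
rewrite ler_norml; apply/andP; split.
  have := sqr_ge0 (f x + g x); have := sqr_ge0 (f x); have := sqr_ge0 (g x).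
  by rewrite sqrrD; lra.
have := sqr_ge0 (f x - g x); have := sqr_ge0 (f x); have := sqr_ge0 (g x).
by rewrite sqrrB; lra.
Qed.

Lemma bounded_square_integrable D (M : R) (f : T -> R) : measurable D ->
  (mu D < +oo)%E -> measurable_fun D f ->
  {ae mu, forall x, D x -> `|f x| <= M} -> square_integrable D f.
Proof.
move=> mD fD mf fM; split => //.
have := @ae_le_normr_Rintegral D (fun x => f x ^+ 2) (fun=> M ^+ 2) mD.
case=> //.
- exact: measurable_funX.
- exact: cst_integrable.
- by move=> x _; exact: sqr_ge0.
apply: filterS fM => x h Dx; rewrite ger0_norm ?sqr_ge0//.
rewrite -[leLHS]real_normK ?num_real//.
by rewrite lerXn2r ?nnegrE// ?h// (le_trans _ (h Dx)).
Qed.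

(** ** Forms given by an integral *)

Lemma psd_on_integral (V : lmodType R) (Z : set V) D (k : T -> V -> V -> R) :
  measurable D -> 
  (forall U W, Z U -> Z W -> mu.-integrable D (EFin \o (fun x => k x U W))) ->
  (forall x c U U' W, D x -> k x (c *: U + U') W = c * k x U W + k x U' W) ->
  (forall x U W, D x -> k x U W = k x W U) ->
  (forall x U, D x -> 0 <= k x U U) ->
  psd_on Z (fun U W => \int[mu]_(x in D) k x U W).
Proof.
move=> mD ik kl ks k0; split.
- move=> W ZW c U U' ZU ZU'.
  have -> : \int[mu]_(x in D) k x (c *: U + U') W =
      \int[mu]_(x in D) (c * k x U W + k x U' W).
    by apply: eq_Rintegral => x; rewrite inE => Dx; exact: kl.
  rewrite RintegralD//; last 2 first.
  - by have := integrableZl mD c (ik U W ZU ZW); apply: eq_integrable.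
  - exact: ik.
  by rewrite RintegralZl//; exact: ik.
- move=> U W _ _; apply: eq_Rintegral => x; rewrite inE; exact: ks.
- by move=> U _; apply: Rintegral_ge0 => x; exact: k0.
Qed.

Lemma linear_on_Rintegral_mul D (g : T -> R) : measurable D ->
  square_integrable D g ->
  linear_on (square_integrable D) (fun f : T -> R => \int[mu]_(x in D) (g x * f x)).
Proof.
move=> mD sg c f f' sf sf'.
have i1 := square_integrable_mul mD sg sf.
have i2 := square_integrable_mul mD sg sf'.
have i1' : mu.-integrable D (EFin \o (fun x => c * (g x * f x))).
  by have := integrableZl mD c i1; apply: eq_integrable.
rewrite -RintegralZl// -RintegralD//; apply: eq_Rintegral => x _.
by rewrite mulrCA -mulrDr.
Qed.

End Integration.

(** * Primitives and weak derivatives on the line *)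

Section Primitives.
Variable R : realType.
Implicit Types (f g p l eta : R -> R).
Local Notation mu := (@lebesgue_measure R).

Lemma is_derive_continuous f (df t : R) :
  is_derive t 1 f df -> {for t, continuous f}.
Proof.
by move=> H; apply: differentiable_continuous; apply/derivable1_diffP; have [] := H.
Qed.

Lemma MVT_everywhere f (df : R -> R) (a b : R) : a < b ->
  (forall x : R, is_derive x 1 f (df x)) ->
  exists c, [/\ a < c, c < b & f b - f a = df c * (b - a)].
Proof.
move=> ab H; have cf : {within `[a, b], continuous f}.
  by apply: derivable_within_continuous => c _; have [] := H c.
have [c] := MVT ab (fun x _ => H x) cf.
by rewrite in_itv/= => /andP[ac cb] E; exists c.
Qed.

Lemma continuous_integrable_itv g (a b : R) : continuous g ->
  mu.-integrable `[a, b] (EFin \o g).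
Proof.
move=> cg; apply: continuous_compact_integrable; first exact: segment_compact.
exact: continuous_subspaceT.
Qed.

Lemma Rintegral_itv_split g (a x b : R) : continuous g -> a <= x -> x <= b ->
  \int[mu]_(t in `[a, b]) g t =
  \int[mu]_(t in `[a, x]) g t + \int[mu]_(t in `[x, b]) g t.
Proof.
move=> cg ax xb; apply/eqP; rewrite addrC -subr_eq; apply/eqP.
rewrite Rintegral_itvB ?bnd_simp//; last exact: continuous_integrable_itv.
rewrite Rintegral_itv_obnd_cbnd//.
apply: (@integrableS _ _ _ mu `[x, b]) => //; first exact: subset_itv_oc_cc.
exact: continuous_integrable_itv.
Qed.

Lemma antiderivE g (a t : R) : continuous g -> a <= 0 -> a <= t ->
  antideriv g t = \int[mu]_(y in `[a, t]) g y - \int[mu]_(y in `[a, 0]) g y.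
Proof.
move=> cg a0 at_; rewrite /antideriv; case: ifPn => [t0|].
  by rewrite (Rintegral_itv_split cg a0 t0); ring.
rewrite -ltNge => t0; rewrite (Rintegral_itv_split cg at_ (ltW t0)); ring.
Qed.

Lemma antideriv_is_derive g : continuous g ->
  forall t : R, is_derive t 1 (antideriv g) (g t).
Proof.
move=> cg t; pose a := - `|t| - 1.
have a0 : a <= 0 by rewrite /a; have := normr_ge0 t; lra.
have at_ : a < t by rewrite /a; have := ler_norm (- t); rewrite normrN; lra.
have tt : t < t + 1 by rewrite ltrDl.
have [d1 d2] := continuous_FTC1_closed tt
  (continuous_integrable_itv a (t + 1) cg) at_ (cg t).
pose F x := \int[mu]_(s in `[a, x]) g s.
have dF : is_derive t 1 (fun x => F x - \int[mu]_(y in `[a, 0]) g y) (g t).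
  have dF : is_derive t 1 F (g t).
    by split; [exact: d1|rewrite -derive1E; exact: d2].
  have := is_deriveB dF (is_derive_cst (\int[mu]_(y in `[a, 0]) g y) t 1).
  by rewrite subr0.
apply: near_eq_is_derive dF.
near=> s; rewrite (antiderivE cg a0)// ltW//; near: s; exact: lt_nbhsr.
Unshelve. all: by end_near. Qed.

Lemma eq_Rintegral_oo f g F (a b : R) : a < b -> continuous g ->
  (forall x : R, is_derive x 1 F (g x)) ->
  (forall x, a < x -> x < b -> f x = g x) ->
  \int[mu]_(x in `]a, b[) f x = F b - F a.
Proof.
move=> ab cg dF fg.
have -> : \int[mu]_(x in `]a, b[) f x = \int[mu]_(x in `]a, b[) g x.
  by apply: eq_Rintegral => x; rewrite inE/= in_itv/= => /andP[ax xb]; rewrite fg.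
have ic := continuous_integrable_itv a b cg.
rewrite Rintegral_itv_bndo_bndc; last first.
  by apply: integrableS ic => //; exact: subset_itv_oo_cc.
rewrite Rintegral_itv_obnd_cbnd; last first.
  by apply: integrableS ic => //; exact: subset_itv_oc_cc.
rewrite /Rintegral (@continuous_FTC2 R g F a b ab)//.
- exact: continuous_subspaceT.
- split.
  + by move=> x _; have [] := dF x.
  + apply: cvg_at_right_filter; exact: is_derive_continuous (dF a).
  + apply: cvg_at_left_filter; exact: is_derive_continuous (dF b).
- by move=> x _; rewrite derive1E; apply: derive_val.
Qed.

(** An interval is not negligible, so a bound valid almost everywhere holds at
every point of continuity. *)
Lemma ae_le_continuous g (a b c t : R) : a < t -> t < b ->
  {ae mu, forall s : R, a < s -> s < b -> g s <= c} ->
  {for t, continuous g} -> g t <= c.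
Proof.
move=> at_ tb [M [mM M0 gM]] gc; rewrite leNgt; apply/negP => gt.
have near_big : \forall s \near t, [/\ a < s, s < b & c < g s].
  near=> s; split.
  - by near: s; exact: lt_nbhsr.
  - by near: s; exact: lt_nbhsl.
  - by near: s; exact: (@cvgr_gt _ _ _ _ _ _ gc).
have [r r0 rP] := near_dist near_big.
pose I : set R := `]t - r, t + r[%classic.
have sub : I `<=` M.
  move=> s; rewrite /I /= in_itv/= => /andP[s1 s2]; apply: gM => /= H.
  have sr : `|s - t| < r by rewrite ltr_norml; apply/andP; split; lra.
  by have [as_ sb] := rP s sr; rewrite ltNge H.
have : (mu I <= mu M)%E.
  by apply: le_measure => //; rewrite inE//; exact: measurable_itv.
rewrite M0 /I lebesgue_measure_itv/= lte_fin ifT; last lra.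
by rewrite leNgt lte_fin => /negP; apply; lra.
Unshelve. all: by end_near. Qed.

Lemma is_derive0_cst_on f (df : R -> R) (a b : R) :
  (forall x : R, is_derive x 1 f (df x)) -> a <= b ->
  (forall x, a < x -> x < b -> df x = 0) -> f a = f b.
Proof.
move=> H; rewrite le_eqVlt => /predU1P[->//|ab] d0.
have [c [ac cb]] := MVT_everywhere ab H.
by rewrite d0// mul0r => /eqP; rewrite subr_eq0 => /eqP.
Qed.

(** The du Bois-Reymond lemma.  With [L] a primitive of [l], the test function
with derivative [k * (p - L - m)], where [k] is a bump supported in [[a, b]]
and [m] the [k]-weighted mean of [p - L], turns the weak identity into
[\int k * (p - L - m) ^+ 2 = 0]. *)
Lemma dubois_reymond (T : R) p l :
  (forall t, 0 < t -> t < T -> {for t, continuous p}) ->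
  (forall t, 0 < t -> t < T -> {for t, continuous l}) ->
  (forall eta, time_test T eta ->
    \int[mu]_(t in `]0, T[) (derive1 eta t * p t) =
    - \int[mu]_(t in `]0, T[) (eta t * l t)) ->
  forall t, 0 < t -> t < T -> is_derive t 1 p (l t).
Proof.
move=> cp cl H t t0 tT.
pose a := t / 2; pose b := (t + T) / 2.
have a0 : 0 < a by rewrite divr_gt0.
have at_ : a < t by rewrite /a; lra.
have tb : t < b by rewrite /b; lra.
have bT : b < T by rewrite /b; lra.
have ab : a < b by exact: lt_trans tb.
(* Clamping to [[a, b]] extends [p] and [l] continuously to the line. *)
pose c r := Num.max a (Num.min b r).
have cc : continuous c.
  move=> r; apply: (@continuous_max R R (cst a) (Num.min b)).
    exact: cst_continuous.
  apply: (@continuous_min R R (cst b) id); first exact: cst_continuous.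
  exact: cvg_id.
have cE r : a <= r -> r <= b -> c r = r.
  by move=> ar rb; rewrite /c (min_idPr rb) (max_idPr ar).
have cI r : 0 < c r /\ c r < T.
  split; first by rewrite /c lt_max a0.
  by rewrite /c gt_max (lt_trans ab bT)/= gt_min bT.
pose pc r := p (c r); pose lc r := l (c r).
have cpc : continuous pc.
  by move=> r; apply: continuous_comp; [exact: cc|have [? ?] := cI r; exact: cp].
have clc : continuous lc.
  by move=> r; apply: continuous_comp; [exact: cc|have [? ?] := cI r; exact: cl].
pose L := antideriv lc.
have dL (r : R) : is_derive r 1 L (lc r) by exact: antideriv_is_derive.
have cL : continuous L by move=> r; exact: is_derive_continuous (dL r).
pose k r := Num.max 0 ((r - a) * (b - r)).
have ck : continuous k.
  move=> r; apply: (@continuous_max R R (cst 0) (fun r => (r - a) * (b - r))).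
    exact: cst_continuous.
  by apply: continuousM; apply: continuousB;
    try exact: cst_continuous; exact: cvg_id.
have k0 r : 0 <= k r by rewrite /k le_max lexx.
have kpos r : a < r -> r < b -> 0 < k r.
  by move=> ar rb; rewrite /k lt_max mulr_gt0 ?orbT// subr_gt0.
have kout r : ~ (a <= r <= b) -> k r = 0.
  move=> out; apply/max_idPl; rewrite leNgt; apply/negP => pos; apply: out.
  have [ar|ra] := leP a r; last first.
    by move: pos; rewrite pmulr_lgt0 ?subr_gt0 ?(lt_trans ra ab)//; lra.
  have [rb|br] := leP r b => //.
  by move: pos; rewrite pmulr_rgt0 ?subr_gt0 ?(lt_trans ab br)//; lra.
have k0' r : r < a \/ b < r -> k r = 0.
  by move=> rab; apply: kout => /andP[ar rb]; case: rab; rewrite ltNge ?ar ?rb.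
pose K := antideriv k.
have dK (r : R) : is_derive r 1 K (k r) by exact: antideriv_is_derive.
have Kab : 0 < K b - K a.
  have [x [ax xb ->]] := MVT_everywhere ab dK.
  by rewrite mulr_gt0 ?kpos// subr_gt0.
pose h r := k r * (pc r - L r).
have ch : continuous h.
  move=> r; apply: continuousM; first exact: ck.
  by apply: continuousB; [exact: cpc|exact: cL].
pose A := antideriv h.
have dA (r : R) : is_derive r 1 A (h r) by exact: antideriv_is_derive.
pose m := (A b - A a) / (K b - K a).
pose eta r := A r - m * K r - (A a - m * K a).
pose g r := h r - m * k r.
have deta (r : R) : is_derive r 1 eta (g r).
  have := is_deriveB (is_deriveB (dA r) (is_deriveZ m (dK r)))
    (is_derive_cst (A a - m * K a) r 1).
  by rewrite subr0.
have cg : continuous g.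
  move=> r; apply: continuousB; first exact: ch.
  by apply: continuousM; [exact: cst_continuous|exact: ck].
have gE r : g r = k r * (pc r - L r - m) by rewrite /g /h; ring.
have etaa : eta a = 0 by rewrite /eta subrr.
have etab : eta b = 0 by rewrite /eta /m; field; rewrite gt_eqF.
have etaout r : ~ (a <= r <= b) -> eta r = 0.
  move=> out; have [ra|ar] := ltP r a.
    rewrite (is_derive0_cst_on deta (ltW ra)) ?etaa// => x _ xa.
    by rewrite gE k0' ?mul0r//; left.
  have [rb|br] := leP r b; first by exfalso; apply: out; rewrite ar rb.
  rewrite -(is_derive0_cst_on deta (ltW br)) ?etab// => x bx _.
  by rewrite gE k0' ?mul0r//; right.
have eta'E : derive1 eta = g.
  by apply/funext => r; rewrite derive1E; have [] := deta r.
have /H : time_test T eta.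
  split; first by move=> r; have [] := deta r.
  - by rewrite eta'E.
  - by exists a, b.
rewrite eta'E.
pose A1 := antideriv (fun r => g r * pc r).
pose A2 := antideriv (fun r => eta r * lc r).
have ceta : continuous eta by move=> r; exact: is_derive_continuous (deta r).
have c1 : continuous (fun r => g r * pc r).
  by move=> r; apply: continuousM; [exact: cg|exact: cpc].
have c2 : continuous (fun r => eta r * lc r).
  by move=> r; apply: continuousM; [exact: ceta|exact: clc].
have d1 (r : R) : is_derive r 1 A1 (g r * pc r) by exact: antideriv_is_derive.
have d2 (r : R) : is_derive r 1 A2 (eta r * lc r) by exact: antideriv_is_derive.
have T0 : 0 < T by apply: lt_trans tT.
rewrite (eq_Rintegral_oo T0 c1 d1); last first.
  move=> x _ _; have [/andP[ax xb]|out] := pselect (a <= x <= b).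
    by rewrite /pc cE.
  by rewrite gE kout ?mul0r.
rewrite (eq_Rintegral_oo T0 c2 d2); last first.
  move=> x _ _; have [/andP[ax xb]|out] := pselect (a <= x <= b).
    by rewrite /lc cE.
  by rewrite etaout ?mul0r.
move=> A12.
(* The derivative of [W] is the weighted square [w]; as [eta] vanishes at [0] and [T],
   the weak identity says that [W 0 = W T]. *)
pose W r := A1 r + A2 r - eta r * L r - m * eta r.
pose w r := k r * (pc r - L r - m) ^+ 2.
have dW (r : R) : is_derive r 1 W (w r).
  have -> : w r = g r * pc r + eta r * lc r
      - (eta r *: lc r + L r *: g r) - m *: g r.
    have sE (x y : R) : x *: y = x * y by [].
    by rewrite !sE /w gE; ring.
  exact: (is_deriveB (is_deriveB (is_deriveD (d1 r) (d2 r))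
    (is_deriveM (deta r) (dL r))) (is_deriveZ m (deta r))).
have w0 r : 0 <= w r by rewrite /w mulr_ge0 ?sqr_ge0.
have Wmono x y : x <= y -> W x <= W y.
  rewrite le_eqVlt => /predU1P[->//|xy].
  have [z [_ _ E]] := MVT_everywhere xy dW.
  by rewrite -subr_ge0 E mulr_ge0// subr_ge0 ltW.
have eta0 : eta 0 = 0 by apply: etaout; rewrite leNgt a0.
have etaT : eta T = 0 by apply: etaout; rewrite andbC leNgt bT.
have W0T : W 0 = W T by rewrite /W eta0 etaT; lra.
have Wcst x : 0 <= x -> x <= T -> W x = W 0.
  move=> x0 xT; apply/eqP; rewrite eq_le (Wmono 0 x)// andbT W0T; exact: Wmono.
have w00 x : 0 < x -> x < T -> w x = 0.
  move=> x0 xT; have e : is_derive x 1 W 0.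
    have c0 : is_derive x 1 (cst (W 0)) 0 by exact: is_derive_cst.
    apply: near_eq_is_derive c0.
    near=> s; apply/esym; apply: Wcst; apply: ltW; near: s; [exact: lt_nbhsr|exact: lt_nbhsl].
  by have [_ <-] := dW x; have [_ ->] := e.
have pE x : a < x -> x < b -> p x = L x + m.
  move=> ax xb; have := w00 x (lt_trans a0 ax) (lt_trans xb bT).
  move=> /eqP; rewrite /w mulf_eq0 gt_eqF ?kpos//= sqrf_eq0 subr_eq0 => /eqP.
  by rewrite /pc cE ?ltW// => <-; ring.
have -> : l t = lc t by rewrite /lc cE// ltW.
have dLm : is_derive t 1 (fun x => L x + m) (lc t).
  by have := is_deriveD (dL t) (is_derive_cst m t 1); rewrite addr0.
apply: near_eq_is_derive dLm.
near=> s; rewrite pE//; near: s; [exact: lt_nbhsr|exact: lt_nbhsl].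
Unshelve. all: by end_near. Qed.

End Primitives.

(** * Superposition operators *)

Section Superposition.
Variable R : realType.
Implicit Types (f : R -> R).

Lemma C1_continuous f : C1 f -> continuous f.
Proof.
move=> [df _] t; apply: differentiable_continuous; exact/derivable1_diffP.
Qed.

Lemma continuous_bounded_on f (M : R) : continuous f ->
  exists2 K : R, 0 <= K & forall x, `|x| <= M -> `|f x| <= K.
Proof.
move=> cf; have [M0|M0] := leP 0 M; last first.
  by exists 0 => // x xM; have := normr_ge0 x; lra.
have cnf : {within `[- M, M], continuous (fun x => `|f x|)}.
  apply: continuous_subspaceT => x.
  by apply: continuous_comp; [exact: cf|exact: norm_continuous].
have MM : - M <= M by lra.
have [c cM cmax] := EVT_max MM cnf.
exists `|f c| => // x; rewrite ler_norml => /andP[x1 x2].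
by apply: cmax; rewrite in_itv/= x1 x2.
Qed.

(** One constant serves all local estimates of a nonlinearity and its
primitive on [[- M, M]]. *)
Definition C1_bound f (M K : R) : Prop := forall x y, `|x| <= M -> `|y| <= M ->
  [/\ `|f x| <= K, `|f x - f y| <= K * `|x - y|,
      `|antideriv f x - antideriv f y| <= K * `|x - y|
    & `|antideriv f x - antideriv f y - f y * (x - y)| <= K * (x - y) ^+ 2].

Lemma between_bounded (M a b c : R) : `|a| <= M -> `|b| <= M ->
  a < c -> c < b -> `|c| <= M.
Proof.
rewrite !ler_norml => /andP[? ?] /andP[? ?] ? ?.
by apply/andP; split; lra.
Qed.

Lemma MVT_bounded f (df : R -> R) (M x y : R) :
  (forall z : R, is_derive z 1 f (df z)) -> `|x| <= M -> `|y| <= M ->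
  exists z, [/\ `|z| <= M, `|z - y| <= `|x - y| & f x - f y = df z * (x - y)].
Proof.
move=> H xM yM; have [xy|yx|->] := ltgtP x y; last first.
- by exists y; rewrite !subrr normr0 mulr0; split.
- have [z [yz zx E]] := MVT_everywhere yx H; exists z; split => //.
    exact: (between_bounded yM xM).
  by rewrite !gtr0_norm ?subr_gt0// lerD2r ltW.
- have [z [xz zy E]] := MVT_everywhere xy H; exists z; split.
  + exact: (between_bounded xM yM).
  + by rewrite !ltr0_norm ?subr_lt0// lerN2 lerD2r ltW.
  + by rewrite -opprB E; ring.
Qed.

Lemma C1_bounded f (M : R) : C1 f -> exists2 K : R, 0 <= K & C1_bound f M K.
Proof.
move=> Cf; have cf := C1_continuous Cf; have [df cdf] := Cf.
have [K1 K10 H1] := continuous_bounded_on M cf.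
have [K2 K20 H2] := continuous_bounded_on M cdf.
have K0 : 0 <= K1 + K2 by rewrite addr_ge0.
exists (K1 + K2) => // x y xM yM.
have df' (z : R) : is_derive z 1 f (derive1 f z).
  by rewrite derive1E; apply: derivableP.
have lip u v : `|u| <= M -> `|v| <= M -> `|f u - f v| <= (K1 + K2) * `|u - v|.
  move=> uM vM; have [z [zM _ ->]] := MVT_bounded df' uM vM.
  rewrite normrM ler_wpM2r//; apply: le_trans (H2 _ zM) _; lra.
have [z [zM zy E]] := MVT_bounded (antideriv_is_derive cf) xM yM.
split.
- by apply: le_trans (H1 _ xM) _; lra.
- exact: lip.
- rewrite E normrM ler_wpM2r//; apply: le_trans (H1 _ zM) _; lra.
rewrite E -mulrBl normrM -[_ ^+ 2]real_normK ?num_real// expr2 mulrA ler_wpM2r//.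
by apply: le_trans (lip _ _ zM yM) _; rewrite ler_wpM2l.
Qed.

Section Integrals.
Context d (T : measurableType d) (mu : {measure set T -> \bar R}) (D : set T).
Variables (f : R -> R) (M K : R).
Hypotheses (mD : measurable D) (fD : (mu D < +oo)%E).
Hypotheses (Cf : C1 f) (K0 : 0 <= K) (fMK : C1_bound f M K).
Implicit Types (u v xi : T -> R).

Definition bounded_by (N : R) u : Prop :=
  measurable_fun D u /\ {ae mu, forall x, D x -> `|u x| <= N}.

Let cst_int (N : R) : mu.-integrable D (EFin \o cst N).
Proof. exact: cst_integrable. Qed.

Lemma measurable_superposition (g : R -> R) u : continuous g ->
  measurable_fun D u -> measurable_fun D (fun x => g (u x)).
Proof.
move=> cg mu_; apply: measurableT_comp => //.
exact: continuous_measurable_fun.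
Qed.

Lemma continuous_antideriv : continuous (antideriv f).
Proof.
by move=> t; apply: is_derive_continuous (antideriv_is_derive (C1_continuous Cf) t).
Qed.

Lemma superposition_square_integrable u : bounded_by M u ->
  square_integrable mu D (fun x => f (u x)).
Proof.
move=> [mu_ uM]; apply: (bounded_square_integrable (M := K)) => //.
  apply: measurable_superposition => //; exact: C1_continuous.
by apply: filterS uM => x h /h uxM; have [] := fMK uxM uxM.
Qed.

Lemma antideriv_integrable u : bounded_by M u ->
  mu.-integrable D (EFin \o (fun x => antideriv f (u x))).
Proof.
move=> [mu_ uM].
have [] := @ae_le_normr_Rintegral _ _ _ mu D (fun x => antideriv f (u x))
  (fun=> K * (2 * `|M|) + `|antideriv f M|) mD => //.
- exact: measurable_superposition continuous_antideriv mu_.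
- exact: cst_int.
- move=> x _; apply: addr_ge0 => //.
  by apply: mulr_ge0 => //; apply: mulr_ge0.
apply: filterS uM => x h /h uxM.
have M0 : 0 <= M by exact: le_trans uxM.
have MM : `|M| <= M by rewrite ger0_norm.
have [_ _ H _] := fMK uxM MM.
have H2 : `|u x - M| <= 2 * `|M|.
  by apply: le_trans (ler_normB _ _) _; rewrite (ger0_norm M0); lra.
rewrite -[in leLHS](subrK (antideriv f M) (antideriv f (u x))).
apply: le_trans (ler_normD _ _) _; rewrite lerD2r.
by apply: le_trans H _; rewrite ler_wpM2l.
Qed.

Lemma superposition_pairing_continuous u v xi (e : R) : 0 <= e ->
  bounded_by M u -> bounded_by M v -> square_integrable mu D xi ->
  {ae mu, forall x, D x -> `|u x - v x| <= e} ->
  `|\int[mu]_(x in D) (f (u x) * xi x) - \int[mu]_(x in D) (f (v x) * xi x)|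
    <= e * (K * \int[mu]_(x in D) `|xi x|).
Proof.
move=> e0 bu bv sxi uve; have [[mu_ uM] [mv vM]] := (bu, bv).
have su := superposition_square_integrable bu.
have sv := superposition_square_integrable bv.
have iu := square_integrable_mul mD su sxi.
have iv := square_integrable_mul mD sv sxi.
have ixi : mu.-integrable D (EFin \o (fun x => `|xi x|)).
  apply: integrable_norm.
  have s1 : square_integrable mu D (cst 1).
    by split => //; exact: (cst_int (1 ^+ 2)).
  by have := square_integrable_mul mD s1 sxi; apply: eq_integrable => // x _ /=; rewrite mul1r.
rewrite -RintegralB// mulrA -RintegralZl//.
have [] := @ae_le_normr_Rintegral _ _ _ mu D
  (fun x => f (u x) * xi x - f (v x) * xi x) (fun x => e * K * `|xi x|) mD => //.
- by apply: measurable_funB; apply/measurable_EFinP; exact: (measurable_int mu).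
- by have := integrableZl mD (e * K) ixi; apply: eq_integrable.
- by move=> x _; rewrite mulr_ge0// mulr_ge0.
apply: filterS3 uM vM uve => x h1 h2 h3 Dx.
rewrite -mulrBl normrM ler_wpM2r//.
have [_ H _ _] := fMK (h1 Dx) (h2 Dx).
by apply: le_trans H _; rewrite mulrC ler_wpM2r// h3.
Qed.

Lemma superposition_pairing_bounded u xi (e : R) : 0 <= e ->
  bounded_by M u -> bounded_by e xi ->
  `|\int[mu]_(x in D) (f (u x) * xi x)| <= e * (K * fine (mu D)).
Proof.
move=> e0 bu [mxi xie]; have [mu_ uM] := bu.
have [] := @ae_le_normr_Rintegral _ _ _ mu D
  (fun x => f (u x) * xi x) (fun x => e * K) mD => //.
- apply: measurable_funM => //; apply: measurable_superposition => //.
  exact: C1_continuous.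
- exact: cst_int.
- by move=> x _; rewrite mulr_ge0.
- apply: filterS2 uM xie => x h1 h2 Dx; rewrite normrM mulrC.
  by apply: ler_pM => //; [exact: h2|have [] := fMK (h1 Dx) (h1 Dx)].
by rewrite Rintegral_cst// mulrA.
Qed.

Lemma antideriv_continuous_bound u v (e : R) : 0 <= e ->
  bounded_by M u -> bounded_by M v ->
  {ae mu, forall x, D x -> `|u x - v x| <= e} ->
  `|\int[mu]_(x in D) antideriv f (u x) - \int[mu]_(x in D) antideriv f (v x)|
    <= e * (K * fine (mu D)).
Proof.
move=> e0 bu bv uve; have [[mu_ uM] [mv vM]] := (bu, bv).
have [iu iv] := (antideriv_integrable bu, antideriv_integrable bv).
rewrite -RintegralB// mulrA -Rintegral_cst//.
have [] := @ae_le_normr_Rintegral _ _ _ mu D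
  (fun x => antideriv f (u x) - antideriv f (v x)) (fun x => e * K) mD => //.
- by apply: measurable_funB; apply/measurable_EFinP; exact: (measurable_int mu).
- exact: cst_int.
- by move=> x _; rewrite mulr_ge0.
apply: filterS3 uM vM uve => x h1 h2 h3 Dx.
have [_ _ H _] := fMK (h1 Dx) (h2 Dx).
by apply: le_trans H _; rewrite mulrC ler_wpM2r// h3.
Qed.

Lemma antideriv_expansion u v : bounded_by M u -> bounded_by M v ->
  `|\int[mu]_(x in D) antideriv f (u x) - \int[mu]_(x in D) antideriv f (v x)
    - \int[mu]_(x in D) (f (v x) * (u x - v x))|
    <= K * \int[mu]_(x in D) ((u x - v x) * (u x - v x)).
Proof.
move=> bu bv; have [[mu_ uM] [mv vM]] := (bu, bv).
have [iu iv] := (antideriv_integrable bu, antideriv_integrable bv).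
have suv : square_integrable mu D (fun x => u x - v x).
  have := square_integrable_lin (- 1) mD (bounded_square_integrable mD fD mv vM)
    (bounded_square_integrable mD fD mu_ uM).
  by under eq_fun do rewrite mulN1r addrC.
have i1 := square_integrable_mul mD (superposition_square_integrable bv) suv.
have i2 := square_integrable_mul mD suv suv.
have i3 : mu.-integrable D (EFin \o (fun x => antideriv f (u x) - antideriv f (v x))).
  by have := integrableB mD iu iv; apply: eq_integrable.
rewrite -RintegralB// -RintegralB// -RintegralZl//.
have [] := @ae_le_normr_Rintegral _ _ _ mu D
  (fun x => antideriv f (u x) - antideriv f (v x) - f (v x) * (u x - v x))
  (fun x => K * ((u x - v x) * (u x - v x))) mD => //.
- by apply: measurable_funB; apply/measurable_EFinP; exact: (measurable_int mu).
- by have := integrableZl mD K i2; apply: eq_integrable.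
- by move=> x _; rewrite mulr_ge0// -expr2 sqr_ge0.
apply: filterS2 uM vM => x h1 h2 Dx; rewrite -expr2.
by have [] := fMK (h1 Dx) (h2 Dx).
Qed.

Lemma superposition_growth (s alpha c c' : R) u : bounded_by M u ->
  (forall tau, c * tau ^+ 2 - c' <= s * (f tau * tau - alpha * antideriv f tau)) ->
  c * \int[mu]_(x in D) (u x * u x) - c' * fine (mu D) <=
  s * (\int[mu]_(x in D) (f (u x) * u x) -
       alpha * \int[mu]_(x in D) antideriv f (u x)).
Proof.
move=> bu H; have [mu_ uM] := bu.
have su := bounded_square_integrable mD fD mu_ uM.
have i1 := square_integrable_mul mD su su.
have i2 := square_integrable_mul mD (superposition_square_integrable bu) su.
have i3 := antideriv_integrable bu.
have i1' : mu.-integrable D (EFin \o (fun x => c * (u x * u x))).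
  by have := integrableZl mD c i1; apply: eq_integrable.
have i3' : mu.-integrable D (EFin \o (fun x => alpha * antideriv f (u x))).
  by have := integrableZl mD alpha i3; apply: eq_integrable.
have i23 : mu.-integrable D
    (EFin \o (fun x => f (u x) * u x - alpha * antideriv f (u x))).
  by have := integrableB mD i2 i3'; apply: eq_integrable.
rewrite -RintegralZl// -Rintegral_cst// -RintegralB//; last exact: cst_int.
rewrite -[X in _ - X]RintegralZl// -RintegralB// -RintegralZl//.
apply: le_Rintegral => //.
- by have := integrableB mD i1' (cst_int c'); apply: eq_integrable.
- by have := integrableZl mD s i23; apply: eq_integrable.
by move=> x _; rewrite -expr2; exact: H.
Qed.

End Integrals.
End Superposition.

(** * Borel sets and null sets of R^N *)

Section BorelSpace.
Variables (R : realType) (N : nat).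
Local Notation E := 'rV[R]_N.
Local Notation B := (borelRn R N).

Lemma open_measurable_Rn (A : set E) : open A -> measurable (A : set B).
Proof. by move=> oA; exact: sub_sigma_algebra. Qed.

Lemma closed_measurable_Rn (A : set E) : closed A -> measurable (A : set B).
Proof.
move=> cA; rewrite -(setCK A); apply: measurableC; apply: open_measurable_Rn.
exact: closed_openC.
Qed.

Lemma continuous_measurable_Rn (g : E -> R) : continuous g ->
  measurable_fun setT (g : B -> R).
Proof.
move=> cg; apply: (measurability _ (RGenOInfty.measurableE R)) => //.
move=> _ [_ [x ->] <-]; rewrite setTI; apply: open_measurable_Rn.
by apply: open_comp; [move=> y _; exact: cg|exact: interval_open].
Qed.

Lemma measurable_coord (i : 'I_N) : measurable_fun setT (fun x : B => (x : E) 0 i).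
Proof. by apply: continuous_measurable_Rn => x; exact: coord_continuous. Qed.

Lemma enorm_ge0 (v : E) : 0 <= enorm v.
Proof. exact: sqrtr_ge0. Qed.

Lemma enorm_sqr (v : E) : enorm v ^+ 2 = \sum_(i < N) v 0 i ^+ 2.
Proof.
rewrite /enorm sqr_sqrtr.
  by apply: eq_bigr => i _; rewrite expr2.
by apply: sumr_ge0 => i _; rewrite -expr2 sqr_ge0.
Qed.

Lemma coord_le_enorm (v : E) (i : 'I_N) : `|v 0 i| <= enorm v.
Proof.
rewrite -(@ler_sqr R) ?nnegrE ?enorm_ge0// real_normK ?num_real// enorm_sqr.
by rewrite (bigD1 i)//= lerDl sumr_ge0// => j _; rewrite sqr_ge0.
Qed.

Definition box (x : E) (r : R) : set E :=
  [set y | forall i, (x - const_mx r) 0 i <= y 0 i <= (x + const_mx r) 0 i].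

Lemma measurable_box (x : E) (r : R) : measurable (box x r : set B).
Proof.
rewrite (_ : box x r = \bigcap_(i in setT)
   ((fun y : B => (y : E) 0 i) @^-1` `[(x - const_mx r) 0 i, (x + const_mx r) 0 i])).
  apply: fin_bigcap_measurable => // i _.
  by rewrite -[X in measurable X]setTI; apply: measurable_coord.
apply/seteqP; split => y /=.
  by move=> h i _; rewrite /= in_itv/=; exact: h.
by move=> h i; have := h i I; rewrite /= in_itv.
Qed.

Lemma lebesgue_box (lam : {measure set B -> \bar R}) (x : E) (r : R) :
  is_lebesgue lam -> 0 <= r -> lam (box x r) = ((2 * r) ^+ N)%:E.
Proof.
move=> hl r0; rewrite [LHS]hl; last by move=> i; rewrite !mxE; lra.
congr (_%:E); rewrite -[in RHS](card_ord N) -prodr_const.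
by apply: eq_bigr => i _; rewrite !mxE; ring.
Qed.

Lemma ediam_ge0 (F : set E) : (0 <= ediam F)%E.
Proof. by apply: ereal_sup_ubound; left. Qed.

Lemma ediam_box (F : set E) (D : R) : ediam F = D%:E ->
  exists x, F `<=` box x D.
Proof.
move=> FD; have [[x Fx]|F0] := pselect (F !=set0); last first.
  by exists 0 => y Fy; exfalso; apply: F0; exists y.
exists x => y Fy i.
have : ((enorm (x - y))%:E <= ediam F)%E.
  by apply: ereal_sup_ubound; right; exists x, y.
rewrite FD lee_fin => xyD; have := coord_le_enorm (x - y) i.
by rewrite !mxE ler_norml => /andP[? ?]; apply/andP; split; lra.
Qed.

(** A cover by sets of diameter [D_i <= delta] is enlarged to cubes of volume
[(2 * D_i) ^ N], at most [2 ^ N * delta ^ (N - d)] times [D_i ^ d]. *)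
Lemma hausdorff_lebesgue_null (lam : {measure set B -> \bar R}) (d : R)
    (A : set E) : is_lebesgue lam -> 0 < d -> d < N%:R ->
  measurable (A : set B) -> (hausdorff d A < +oo)%E -> lam A = 0%E.
Proof.
move=> hl d0 dN mA hA.
have e0 : 0 < N%:R - d by rewrite subr_gt0.
pose H := fine (hausdorff d A) + 1.
have hA0 : (0 <= hausdorff d A)%E.
  apply: (@le_trans _ _ (hausdorff_pre d 1 A)); last first.
    by apply: ereal_sup_ubound; exists 1 => //=; exact: ltr01.
  apply: le_ereal_inf_tmp => z [F [_ _ ->]].
  by apply: nneseries_ge0 => n _ _; exact: poweR_ge0.
have hfin : hausdorff d A \is a fin_num by rewrite ge0_fin_numE.
have H0 : 0 < H by rewrite ltr_wpDl// fine_ge0.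
have hH : (hausdorff d A < H%:E)%E.
  by rewrite /H EFinD fineK// lteDl// lte_fin.
have bound delta : 0 < delta ->
    (lam A <= (2 ^+ N * delta `^ (N%:R - d) * H)%:E)%E.
  move=> delta0.
  have : (hausdorff_pre d delta A < H%:E)%E.
    apply: le_lt_trans hH; apply: ereal_sup_ubound.
    by exists delta.
  move=> /ereal_inf_lt[_ [F [AF Fd ->]] FH].
  have Ffin i : ediam (F i) = (fine (ediam (F i)))%:E.
    rewrite fineK// ge0_fin_numE ?ediam_ge0//.
    by apply: (le_lt_trans (Fd i)); rewrite ltry.
  pose D i := fine (ediam (F i)).
  have D0 i : 0 <= D i by rewrite fine_ge0// ediam_ge0.
  have Dd i : D i <= delta by rewrite -lee_fin -Ffin.
  have [x xF] := choice (fun i => ediam_box (Ffin i)).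
  have sub : A `<=` \bigcup_i box (x i) (D i).
    by move=> y /AF[i _ Fy]; exists i => //; exact: xF.
  apply: (le_trans (measure_sigma_subadditive lam
    (fun i => measurable_box (x i) (D i)) mA sub)).
  have c0 : 0 <= 2 ^+ N * delta `^ (N%:R - d).
    by rewrite mulr_ge0 ?exprn_ge0 ?powR_ge0.
  apply: (@le_trans _ _ (\sum_(0 <= i <oo)
      ((2 ^+ N * delta `^ (N%:R - d))%:E * ediam (F i) `^ d))%E).
    apply: lee_nneseries => [i _ _|i _]; first exact: measure_ge0.
    rewrite lebesgue_box// (Ffin i) poweR_EFin -EFinM lee_fin -/(D i).
    rewrite exprMn -mulrA ler_wpM2l ?exprn_ge0//.
    have [->|Dn0] := eqVneq (D i) 0.
      rewrite expr0n gtn_eqF ?mulr_ge0 ?powR_ge0//.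
      by rewrite -(@ltr_nat R); exact: lt_trans dN.
    have Dp : 0 < D i by rewrite lt_neqAle eq_sym Dn0 D0.
    rewrite -powR_mulrn// -{1}(subrK d N%:R) powRD; last by rewrite Dn0 implybT.
    rewrite ler_wpM2r ?powR_ge0//; apply: ge0_ler_powR => //.
    + exact: ltW.
    + by rewrite nnegrE ltW.
    + by rewrite nnegrE ltW.
  apply: (@le_trans _ _ ((2 ^+ N * delta `^ (N%:R - d))%:E *
      \sum_(0 <= i <oo) ediam (F i) `^ d)%E).
    rewrite le_eqVlt; apply/orP; left; apply/eqP.
    by apply: nneseriesZl => i _; exact: poweR_ge0.
  by rewrite [leRHS]EFinM; apply: lee_wpmul2l; [rewrite lee_fin|exact: ltW].
apply/eqP; rewrite eq_le measure_ge0 andbT.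
apply/lee_addgt0Pr => e ep; rewrite add0e.
pose delta := (e / (2 ^+ N * H)) `^ (N%:R - d)^-1.
have q0 : 0 < e / (2 ^+ N * H) by rewrite divr_gt0// mulr_gt0// exprn_gt0.
have := bound delta (powR_gt0 _ q0).
rewrite /delta -powRrM mulVf ?gt_eqF// powRr1 ?(ltW q0)//.
rewrite (_ : 2 ^+ N * (e / (2 ^+ N * H)) * H = e)//.
by field; rewrite !gt_eqF// exprn_gt0.
Qed.

End BorelSpace.

(** * The form domain inside a space of square-integrable states *)

Section Problem.
Variables (R : realType) (N : nat) (P : problem R N).
Hypotheses (geo : geometry P) (coef : coefficients P).
Local Notation E := 'rV[R]_N.
Local Notation B := (borelRn R N).
Local Notation Xpair := ((E -> R) * (E -> R))%type.
Local Notation state := ((E -> R) * (E -> E) * (E -> R))%type.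
Local Notation SS := (Sg P `*` Sg P : set (B * B)).
Local Notation mu2 := (muS P \x muS P)%E.

Lemma measurable_Om : measurable (Om P : set B).
Proof. by apply: open_measurable_Rn; have [] := Om_domain geo. Qed.

Lemma measurable_Sg : measurable (Sg P : set B).
Proof.
by apply: closed_measurable_Rn; rewrite (Sg_def geo); apply: closedI;
  exact: closed_closure.
Qed.

Lemma measurable_OmS : measurable (OmS P : set B).
Proof. by apply: measurableD; [exact: measurable_Om|exact: measurable_Sg]. Qed.

Lemma measurable_SS : measurable SS.
Proof. by apply: measurableX; exact: measurable_Sg. Qed.

Lemma lam_Sg0 : lam P (Sg P) = 0%E.
Proof.
apply: (hausdorff_lebesgue_null (lam_lebesgue geo) (dS_gt0 geo) (dS_ltN geo)).
  exact: measurable_Sg.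
exact: Sg_fin geo.
Qed.

Lemma muS_Sg_lty : (muS P (Sg P) < +oo)%E.
Proof. by rewrite -ge0_fin_numE//; apply: fin_num_measure; exact: measurable_Sg. Qed.

(** Under [lam_Sg0] this is the scalar product of X^2 (Omega, Sigma); taking
the first integral over [OmS P] matches the weak equation. *)
Definition X2ip (F G : Xpair) : R :=
  \int[lam P]_(x in OmS P) (F.1 x * G.1 x) +
  \int[muS P]_(x in Sg P) (F.2 x * G.2 x).

Definition L2pair (F : Xpair) : Prop :=
  square_integrable (lam P) (OmS P : set B) F.1 /\
  square_integrable (muS P) (Sg P : set B) F.2.

Lemma L2pair_subspace : subspace L2pair.
Proof.
move=> c F G [F1 F2] [G1 G2]; split.
- exact: (square_integrable_lin c measurable_OmS F1 G1).
- exact: (square_integrable_lin c measurable_Sg F2 G2).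
Qed.

Lemma X2ip_psd : psd_on L2pair X2ip.
Proof.
apply: psd_onD.
- apply: (@psd_on_integral _ _ _ (lam P) _ L2pair (OmS P : set B)
    (fun x F G => F.1 x * G.1 x)).
  + exact: measurable_OmS.
  + move=> F G [F1 _] [G1 _]; exact: (square_integrable_mul measurable_OmS F1 G1).
  + by move=> x c F F' G _; rewrite mulrDl -mulrA.
  + by move=> x F G _; rewrite mulrC.
  + by move=> x F _; rewrite -expr2 sqr_ge0.
- apply: (@psd_on_integral _ _ _ (muS P) _ L2pair (Sg P : set B)
    (fun x F G => F.2 x * G.2 x)).
  + exact: measurable_Sg.
  + move=> F G [_ F2] [_ G2]; exact: (square_integrable_mul measurable_Sg F2 G2).
  + by move=> x c F F' G _; rewrite mulrDl -mulrA.
  + by move=> x F G _; rewrite mulrC.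
  + by move=> x F _; rewrite -expr2 sqr_ge0.
Qed.

(** With the square root of the kernel included, the nonlocal part of the form
is an L^2 scalar product of increments. *)
Definition kernel_increment (w : E -> R) (z : B * B) : R :=
  Num.sqrt (kern P z.1 z.2) * (w z.1 - w z.2).

(** A vector space containing the form domain, on which the form is defined
and bilinear; it forgets that the second component is a weak gradient and the
third one a trace. *)
Definition L2state (U : state) : Prop :=
  [/\ L2pair (toX U),
      forall i, square_integrable (lam P) (OmS P : set B) (fun x => U.1.2 x 0 i)
    & square_integrable mu2 SS (kernel_increment U.2)].

Lemma L2state_subspace : subspace L2state.
Proof.
move=> c U W [U1 U2 U3] [W1 W2 W3]; split.
- exact: (L2pair_subspace c U1 W1).
- move=> i; have := square_integrable_lin c measurable_OmS (U2 i) (W2 i).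
  by congr square_integrable; apply/funext => x; rewrite /= !mxE.
- have := square_integrable_lin c measurable_SS U3 W3.
  congr square_integrable; apply/funext => z.
  have lin x : (c *: U + W).2 x = c * U.2 x + W.2 x by [].
  by rewrite /kernel_increment !lin; ring.
Qed.

Lemma X2ip_state_psd : psd_on L2state (fun U W => X2ip (toX U) (toX W)).
Proof.
have [l s p] := X2ip_psd; split.
- move=> W [ZW _ _] c U U' [ZU _ _] [ZU' _ _].
  exact: (l (toX W) ZW c (toX U) (toX U') ZU ZU').
- by move=> U W [ZU _ _] [ZW _ _]; exact: s.
- by move=> U [ZU _ _]; exact: p.
Qed.

Lemma DformD (x : E) (c : R) (v v' w : E) :
  Dform P x (c *: v + v') w = c * Dform P x v w + Dform P x v' w.
Proof.
rewrite /Dform mulr_sumr -big_split/=; apply: eq_bigr => i _.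
rewrite mulr_sumr -big_split/=; apply: eq_bigr => j _.
by rewrite !mxE; ring.
Qed.

Lemma DformC (x v w : E) : Om P x -> Dform P x v w = Dform P x w v.
Proof.
move=> Ox; rewrite /Dform exchange_big/=; apply: eq_bigr => i _.
apply: eq_bigr => j _.
have /matrixP/(_ i j) := Dm_sym coef Ox; rewrite mxE => ->.
by ring.
Qed.

Lemma OmS_Om (x : E) : OmS P x -> Om P x. Proof. by case. Qed.

Lemma form_gradient_psd :
  psd_on L2state (fun U W => \int[lam P]_(x in OmS P) Dform P x (U.1.2 x) (W.1.2 x)).
Proof.
have mD := measurable_OmS.
apply: (@psd_on_integral _ _ _ (lam P) _ L2state (OmS P : set B)
    (fun x U W => Dform P x (U.1.2 x) (W.1.2 x))) => //.
- move=> U W [_ U2 _] [_ W2 _]; rewrite /Dform.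
  have [C HC] := Dm_bounded coef.
  rewrite (_ : EFin \o _ = (fun x => \sum_(i < N) \sum_(j < N)
    (Dm P x i j * U.1.2 x 0 j * W.1.2 x 0 i)%:E)%E); last first.
    apply/funext => x; rewrite /= -sumEFin; apply: eq_bigr => i _.
    by rewrite -sumEFin.
  apply: integrable_sum => // i _; apply: integrable_sum => // j _.
  have sU : square_integrable (lam P) (OmS P : set B)
      (fun x => Dm P x i j * U.1.2 x 0 j).
    apply: (square_integrable_bounded (M := C)) => //.
    - apply: measurable_funS (Dm_meas coef i j); first exact: measurable_Om.
      exact: OmS_Om.
    - by move=> x /OmS_Om; exact: HC.
  exact: (square_integrable_mul mD sU (W2 i)).
- by move=> x c U U' W _; exact: DformD.
- by move=> x U W /OmS_Om Ox; exact: DformC.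
move=> x U /OmS_Om Ox; have [d0 d00 H] := Dm_elliptic coef.
by apply: le_trans (H x _ Ox); rewrite mulr_ge0 ?sqr_ge0// ltW.
Qed.

Lemma form_boundary_psd :
  psd_on L2state (fun U W => \int[muS P]_(x in Sg P) (betaS P x * U.2 x * W.2 x)).
Proof.
have mD := measurable_Sg.
have [b0 [b1 [b00 Hb]]] := beta_bounds coef.
(* [betaS P] obeys its bounds only almost everywhere; its truncation obeys
   them everywhere. *)
pose beta' x := Num.max 0 (Num.min (betaS P x) b1).
have b1' x : `|beta' x| <= `|b1|.
  rewrite ger0_norm /beta' ?le_max ?lexx// ge_max normr_ge0/=.
  by rewrite ge_min ler_norm orbT.
have mb : measurable_fun (Sg P : set B) (beta' : B -> R).
  apply: measurable_maxr => //; apply: measurable_minr => //.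
  exact: (beta_meas coef).
apply: (@psd_on_eq _ _ L2state (fun U W =>
    \int[muS P]_(x in Sg P) (beta' x * U.2 x * W.2 x))).
  move=> U W; apply: Rintegral_congr_ae; apply: ae_impl Hb => x H Sx.
  have /andP[h0 h1] := H Sx.
  rewrite /beta' (min_idPl h1) (max_idPr _)//.
  by apply: le_trans h0; exact: ltW.
apply: (@psd_on_integral _ _ _ (muS P) _ L2state (Sg P : set B)
    (fun x U W => beta' x * U.2 x * W.2 x)) => //.
- move=> U W [[_ U2] _ _] [[_ W2] _ _].
  have sU := square_integrable_bounded mD mb (fun x _ => b1' x) U2.
  exact: (square_integrable_mul mD sU W2).
- move=> x c U U' W _; have -> : (c *: U + U').2 x = c * U.2 x + U'.2 x by [].
  by ring.
- by move=> x U W _; ring.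
move=> x U _; rewrite -mulrA -expr2 mulr_ge0 ?sqr_ge0//.
by rewrite /beta' le_max lexx.
Qed.

Lemma form_nonlocal_psd :
  psd_on L2state (fun U W => \int[mu2]_(z in SS)
     (kern P z.1 z.2 * (U.2 z.1 - U.2 z.2) * (W.2 z.1 - W.2 z.2))).
Proof.
have mD := measurable_SS.
have kE (U W : state) z : SS z ->
    kern P z.1 z.2 * (U.2 z.1 - U.2 z.2) * (W.2 z.1 - W.2 z.2) =
    kernel_increment U.2 z * kernel_increment W.2 z.
  move=> [S1 S2]; rewrite /kernel_increment.
  rewrite -[in LHS](sqr_sqrtr (K_ge0 coef S1 S2)); ring.
apply: (@psd_on_integral _ _ _ mu2 _ L2state SS (fun z U W =>
     kern P z.1 z.2 * (U.2 z.1 - U.2 z.2) * (W.2 z.1 - W.2 z.2))) => //.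
- move=> U W [_ _ U3] [_ _ W3].
  apply: eq_integrable (square_integrable_mul mD U3 W3) => //.
  by move=> z; rewrite inE => Sz /=; rewrite kE.
- move=> z c U U' W _.
  have lin x : (c *: U + U').2 x = c * U.2 x + U'.2 x by [].
  by rewrite !lin; ring.
- by move=> z U W _; ring.
by move=> z U Sz; rewrite kE// -expr2 sqr_ge0.
Qed.

Lemma form_psd : psd_on L2state (Defs.form P).
Proof.
apply: psd_onD; last exact: form_nonlocal_psd.
by apply: psd_onD; [exact: form_gradient_psd|exact: form_boundary_psd].
Qed.

Lemma measurable_enormB :
  measurable_fun setT (fun z : B * B => enorm ((z.1 : E) - (z.2 : E))).
Proof.
rewrite /enorm /dotv; apply: measurableT_comp.
  by apply: continuous_measurable_fun => x; exact: sqrt_continuous.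
apply: measurable_sum => i.
have m1 : measurable_fun setT (fun z : B * B => (z.1 : E) 0 i).
  exact: measurableT_comp (measurable_coord i) measurable_fst.
have m2 : measurable_fun setT (fun z : B * B => (z.2 : E) 0 i).
  exact: measurableT_comp (measurable_coord i) measurable_snd.
rewrite (_ : (fun z : B * B => _) =
  (fun z : B * B => (z.1 0 i - z.2 0 i) * (z.1 0 i - z.2 0 i))); last first.
  by apply/funext => z; rewrite !mxE.
by apply: measurable_funM; exact: measurable_funB.
Qed.

Lemma measurable_increment (w : E -> R) : measurable_fun (Sg P : set B) (w : B -> R) ->
  measurable_fun SS (fun z : B * B => w z.1 - w z.2).
Proof.
move=> mw.
have m1 : measurable_fun SS ((w : B -> R) \o fst).
  apply: (measurable_comp measurable_Sg _ mw); last exact: measurable_funTS measurable_fst.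
  by move=> _ [z [S1 _] <-].
have m2 : measurable_fun SS ((w : B -> R) \o snd).
  apply: (measurable_comp measurable_Sg _ mw); last exact: measurable_funTS measurable_snd.
  by move=> _ [z [_ S2] <-].
exact: measurable_funB.
Qed.

Lemma enorm_gt0 (x y : E) : x <> y -> 0 < enorm (x - y).
Proof.
move=> xy; rewrite lt_neqAle enorm_ge0 andbT eq_sym; apply/eqP => e.
apply: xy; apply/rowP => i; apply/eqP; rewrite -subr_eq0 -normr_eq0.
have := coord_le_enorm (x - y) i; rewrite e !mxE => h.
by rewrite eq_le h normr_ge0.
Qed.

Lemma besov_kernel_increment (w : E -> R) : besov P w ->
  square_integrable mu2 SS (kernel_increment w).
Proof.
move=> [[mw _] wfin]; have mD := measurable_SS.
have mi := measurable_increment mw.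
have [c0 [c1 [c00 c01 Hc]]] := K_bounds coef.
pose p := dS P + 2 * sK P.
have mk : measurable_fun SS (fun z : B * B => Num.sqrt (kern P z.1 z.2)).
  apply: measurableT_comp; last exact: (K_meas coef).
  by apply: continuous_measurable_fun => x; exact: sqrt_continuous.
apply: square_integrableP => //; first exact: measurable_funM.
pose g z := (w z.1 - w z.2) ^+ 2 / enorm ((z.1 : E) - (z.2 : E)) `^ p.
have g0 z : 0 <= g z by rewrite /g divr_ge0 ?sqr_ge0 ?powR_ge0.
have mg : measurable_fun SS (g : B * B -> R).
  rewrite /g; under eq_fun do rewrite -powRN; apply: measurable_funM.
    exact: measurable_funX.
  apply: (measurableT_comp (measurable_powR (- p))).
  exact: measurable_funTS measurable_enormB.
have c10 : 0 <= c1 by apply: le_trans c01; exact: ltW.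
apply: (@le_lt_trans _ _ (\int[mu2]_(z in SS) (c1%:E * (g z)%:E))%E); last first.
  rewrite ge0_integralZl_EFin//.
  - by apply: lte_mul_pinfty => //; rewrite lee_fin.
  - by move=> z _; rewrite lee_fin.
  - exact/measurable_EFinP.
apply: ge0_le_integral => //.
- by move=> z _; rewrite lee_fin sqr_ge0.
- by apply/measurable_EFinP; apply: measurable_funX; exact: measurable_funM.
- by apply/measurable_EFinP; exact: measurable_funM.
move=> z [S1 S2]; rewrite -EFinM lee_fin /kernel_increment exprMn.
rewrite sqr_sqrtr ?(K_ge0 coef)// /g.
(* On the diagonal, where the kernel is not controlled, increments vanish. *)
have [zz|zz] := pselect ((z.1 : E) = z.2).
  by rewrite zz subrr expr0n/= mul0r !mulr0.
rewrite [leRHS]mulrCA [leLHS]mulrC; apply: ler_wpM2l; first exact: sqr_ge0.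
rewrite ler_pdivlMr ?powR_gt0 ?enorm_gt0//.
by have /andP[] := Hc _ _ S1 S2 zz.
Qed.

Lemma W12_square_integrable (v : (E -> R) * (E -> E)) : W12 P (OmS P) v ->
  square_integrable (lam P) (OmS P : set B) v.1 /\
  forall i, square_integrable (lam P) (OmS P : set B) (fun x => v.2 x 0 i).
Proof.
move=> [m1 m2 vfin _]; have mD := measurable_OmS.
have mn : measurable_fun (OmS P : set B) (fun x => v.1 x ^+ 2 + enorm (v.2 x) ^+ 2).
  apply: measurable_funD; first exact: measurable_funX.
  under eq_fun do rewrite enorm_sqr.
  by apply: measurable_sum => i; exact: measurable_funX.
split=> [|i]; apply: square_integrableP => //; apply: le_lt_trans vfin;
  apply: ge0_le_integral => //.
- by move=> x _; rewrite lee_fin sqr_ge0.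
- by apply/measurable_EFinP; exact: measurable_funX.
- exact/measurable_EFinP.
- by move=> x _; rewrite lee_fin lerDl sqr_ge0.
- by move=> x _; rewrite lee_fin sqr_ge0.
- by apply/measurable_EFinP; exact: measurable_funX.
- exact/measurable_EFinP.
move=> x _; rewrite lee_fin enorm_sqr (bigD1 i)//=.
have : 0 <= \sum_(j < N | j != i) v.2 x 0 j ^+ 2.
  by apply: sumr_ge0 => j _; rewrite sqr_ge0.
have := sqr_ge0 (v.1 x); lra.
Qed.

Lemma form_dom_L2state (U : state) : form_dom P U -> L2state U.
Proof.
move=> [[hW _] _ hb]; have [s1 s2] := W12_square_integrable hW.
split => //; last exact: besov_kernel_increment.
split => //; have [[mw wfin] _] := hb.
by apply: square_integrableP => //; exact: measurable_Sg.
Qed.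

(** ** The norms of X^oo and X^2 *)

Lemma Lp_oo_bound (mu : {measure set B -> \bar R}) (D : set E) (u : E -> R)
    (c : R) : 0 <= c -> (Lp mu D +oo u <= c%:E)%E ->
  {ae mu, forall x, D x -> `|u x| <= c}.
Proof.
move=> c0; rewrite /Lp unlock; case: ifPn => [_ H|mu0 _]; last first.
  exists setT; split => //.
  by apply/eqP; rewrite eq_le measure_ge0 andbT leNgt.
apply: (ae_impl _ ((ess_supP (mu := mu)) H)) => x /= + Dx.
by rewrite patchE mem_set// lee_fin.
Qed.

Definition sup_le (F : Xpair) (c : R) : Prop :=
  {ae lam P, forall x, Om P x -> `|F.1 x| <= c} /\
  {ae muS P, forall x, Sg P x -> `|F.2 x| <= c}.

Lemma Xnorm_oo_sup_le (F : Xpair) (c : R) : 0 <= c ->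
  (Xnorm P +oo F <= c%:E)%E -> sup_le F c.
Proof. by move=> c0; rewrite /Xnorm ge_max => /andP[? ?]; split; exact: Lp_oo_bound. Qed.

Lemma Lp2_sqr (mu : {measure set B -> \bar R}) (D : set E) (u : E -> R) :
  (Lp mu D 2%:E u `^ 2 = \int[mu]_(x in D) (u x ^+ 2)%:E)%E.
Proof.
rewrite /Lp unlock -poweRrM mulVf ?poweRe1//; last first.
  by apply: integral_ge0 => x _; exact: poweR_ge0.
rewrite [RHS]integral_mkcond; apply: eq_integral => x _ /=.
rewrite !patchE; case: ifPn => _; last by rewrite normr0 powR0.
by rewrite powR_mulrn// real_normK ?num_real.
Qed.

Definition X2sqr (F : Xpair) : \bar R :=
  (\int[lam P]_(x in Om P) (F.1 x ^+ 2)%:E + \int[muS P]_(x in Sg P) (F.2 x ^+ 2)%:E)%E.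

Lemma Xnorm2E (F : Xpair) : Xnorm P 2%:E F = (X2sqr F `^ 2^-1)%E.
Proof. by rewrite /Xnorm !Lp2_sqr. Qed.

Lemma X2sqr_ge0 (F : Xpair) : (0 <= X2sqr F)%E.
Proof. by rewrite adde_ge0// integral_ge0// => x _; rewrite lee_fin sqr_ge0. Qed.

(** Sigma is Lebesgue null. *)
Lemma Om_OmS_integral (u : E -> R) : measurable_fun (Om P : set B) (u : B -> R) ->
  (\int[lam P]_(x in Om P) (u x ^+ 2)%:E =
   \int[lam P]_(x in OmS P) (u x ^+ 2)%:E)%E.
Proof.
move=> mu_; apply: ge0_negligible_integral.
- exact: measurable_Sg.
- exact: measurable_Om.
- by apply/measurable_EFinP; exact: measurable_funX.
- by move=> x _; rewrite lee_fin sqr_ge0.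
- exact: lam_Sg0.
Qed.

Lemma Xnorm2_sqr (F : Xpair) :
  measurable_fun (Om P : set B) (F.1 : B -> R) -> L2pair F ->
  fine (Xnorm P 2%:E F) ^+ 2 = X2ip F F.
Proof.
move=> mF [[_ i1] [_ i2]]; rewrite Xnorm2E fine_poweR powR12_sqrt; last first.
  by rewrite fine_ge0// X2sqr_ge0.
rewrite sqr_sqrtr; last by rewrite fine_ge0// X2sqr_ge0.
rewrite /X2sqr Om_OmS_integral// fineD.
- by rewrite /X2ip /Rintegral; congr (_ + _); congr fine;
    apply: eq_integral => x _; rewrite expr2.
- by apply: (integrable_fin_num measurable_OmS).
- by apply: (integrable_fin_num measurable_Sg).
Qed.

Lemma inX2_L2pair (F : Xpair) : inX P 2%:E F -> L2pair F.
Proof.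
move=> [m1 m2]; rewrite Xnorm2E => fin.
have {}fin : (X2sqr F < +oo)%E.
  rewrite ltNge leye_eq; apply/eqP => e; move: fin.
  by rewrite e poweRyr// invr_neq0.
have [I1 I2] : (\int[lam P]_(x in Om P) (F.1 x ^+ 2)%:E < +oo)%E /\
    (\int[muS P]_(x in Sg P) (F.2 x ^+ 2)%:E < +oo)%E.
  split; apply: le_lt_trans fin.
    by rewrite leeDl// integral_ge0// => x _; rewrite lee_fin sqr_ge0.
  by rewrite leeDr// integral_ge0// => x _; rewrite lee_fin sqr_ge0.
split; last by apply: square_integrableP => //; exact: measurable_Sg.
apply: square_integrableP; first exact: measurable_OmS.
  by apply: measurable_funS m1; [exact: measurable_Om|exact: OmS_Om].
by rewrite -Om_OmS_integral.
Qed.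

Lemma Xnorm2_le (F : Xpair) (C : R) : inX P 2%:E F -> 
  (Xnorm P 2%:E F <= C%:E)%E -> X2ip F F <= C ^+ 2.
Proof.
move=> iF FC; have [m1 m2 fin] := iF.
rewrite -Xnorm2_sqr//; last exact: inX2_L2pair.
have X0 : (0 <= Xnorm P 2%:E F)%E by rewrite Xnorm2E poweR_ge0.
have XC : fine (Xnorm P 2%:E F) <= C by rewrite -lee_fin fineK// ge0_fin_numE.
rewrite lerXn2r ?nnegrE ?fine_ge0//.
by apply: le_trans XC; rewrite fine_ge0.
Qed.

End Problem.

(** * The solution as an abstract gradient flow *)

Lemma ereal_cvg0_le (R : realType) (T : Type) (F : set_system T) {FF : Filter F}
    (g : T -> \bar R) (e : R) : 0 < e -> g x @[x --> F] --> 0%E ->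
  \forall x \near F, (g x <= e%:E)%E.
Proof.
move=> e0 /fine_cvgP[gf g0].
have H := @cvgr_dist_le _ _ _ _ _ _ _ g0 _ e0.
apply: filterS2 gf (H FF) => x gx; rewrite /= sub0r normrN => ge.
by rewrite -(fineK gx) lee_fin (le_trans (ler_norm _)).
Qed.

Lemma normr_subB_le (R : realType) (x x' y y' p q : R) :
  `|x - x'| <= p -> `|y - y'| <= q -> `|(x - y) - (x' - y')| <= p + q.
Proof.
move=> xp yq; rewrite (_ : x - y - (x' - y') = (x - x') - (y - y')); last by ring.
by apply: le_trans (ler_normB _ _) _; rewrite lerD.
Qed.

Section Flow.
Variables (R : realType) (N : nat) (P : problem R N).
Hypotheses (geo : geometry P) (coef : coefficients P).
Local Notation E := 'rV[R]_N.
Local Notation B := (borelRn R N).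
Local Notation Xpair := ((E -> R) * (E -> R))%type.
Local Notation state := ((E -> R) * (E -> E) * (E -> R))%type.
Variables (f h : R -> R) (U : R -> state) (U0 : state).
Hypotheses (Cf : C1 f) (Ch : C1 h).
Hypothesis lam_fin : (lam P (Om P) < +oo)%E.

Let m1 := fine (lam P (OmS P)).
Let m2 := fine (muS P (Sg P)).

Lemma lam_OmS_lty : (lam P (OmS P) < +oo)%E.
Proof.
apply: le_lt_trans lam_fin; apply: le_measure; rewrite ?inE.
- exact: measurable_OmS geo.
- exact: measurable_Om geo.
- exact: OmS_Om.
Qed.

Let fin1 := lam_OmS_lty.
Let fin2 := muS_Sg_lty geo.
Let mD1 := measurable_OmS geo.
Let mD2 := measurable_Sg geo.

Let m10 : 0 <= m1. Proof. exact: fine_ge0. Qed.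
Let m20 : 0 <= m2. Proof. exact: fine_ge0. Qed.

Definition measurable_pair (F : Xpair) : Prop :=
  measurable_fun (OmS P : set B) (F.1 : B -> R) /\
  measurable_fun (Sg P : set B) (F.2 : B -> R).

Lemma inX_measurable_pair p (F : Xpair) : inX P p F -> measurable_pair F.
Proof.
move=> [F1 F2 _]; split => //.
by apply: measurable_funS F1; [exact: measurable_Om geo|exact: OmS_Om].
Qed.

Lemma measurable_pairB (F G : Xpair) :
  measurable_pair F -> measurable_pair G -> measurable_pair (F - G).
Proof. by move=> [? ?] [? ?]; split; exact: measurable_funB. Qed.

Lemma sup_le_bounded_by (F : Xpair) (c : R) : measurable_pair F -> sup_le P F c ->
  bounded_by (lam P) (OmS P : set B) c F.1 /\
  bounded_by (muS P) (Sg P : set B) c F.2.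
Proof.
move=> [mF1 mF2] [s1 s2]; split; split => //.
by apply: ae_impl s1 => x H /OmS_Om; exact: H.
Qed.

Lemma sup_le_X2ip (F : Xpair) (c : R) : measurable_pair F -> sup_le P F c ->
  L2pair P F /\ X2ip P F F <= c ^+ 2 * (m1 + m2).
Proof.
move=> mF sF; have [[mF1 s1] [mF2 s2]] := sup_le_bounded_by mF sF.
split.
  split.
  - exact: (bounded_square_integrable mD1 fin1 mF1 s1).
  - exact: (bounded_square_integrable mD2 fin2 mF2 s2).
have aux (mu : {measure set B -> \bar R}) (D : set B) (u : B -> R) :
    measurable D -> (mu D < +oo)%E -> measurable_fun D u ->
    {ae mu, forall x, D x -> `|u x| <= c} ->
    \int[mu]_(x in D) (u x * u x) <= c ^+ 2 * fine (mu D).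
  move=> mD fD mu_ uc; rewrite -Rintegral_cst//.
  have [] := @ae_le_normr_Rintegral _ _ _ mu D (fun x => u x * u x)
    (fun=> c ^+ 2) mD => //.
  - exact: measurable_funM.
  - exact: cst_integrable.
  - by move=> x _; exact: sqr_ge0.
  - apply: ae_impl uc => x H Dx; rewrite normrM expr2.
    by apply: ler_pM => //; exact: H.
  - by move=> _; apply: le_trans; exact: ler_norm.
rewrite mulrDr /X2ip; apply: lerD; first exact: aux.
exact: (aux (muS P)).
Qed.

Lemma sup_le_near (F G : Xpair) (c e : R) :
  sup_le P (F - G) e -> sup_le P G c -> sup_le P F (c + e).
Proof.
move=> [d1 d2] [g1 g2]; split.
- apply: ae_impl2 d1 g1 => x h1 h2 Ox; rewrite -(subrK (G.1 x) (F.1 x)).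
  apply: le_trans (ler_normD _ _) _; rewrite addrC; apply: lerD; first exact: h2.
  exact: h1.
- apply: ae_impl2 d2 g2 => x h1 h2 Ox; rewrite -(subrK (G.2 x) (F.2 x)).
  apply: le_trans (ler_normD _ _) _; rewrite addrC; apply: lerD; first exact: h2.
  exact: h1.
Qed.

Lemma inXoo_sup_le (F : Xpair) : inX P +oo%E F -> exists2 c : R, 0 <= c & sup_le P F c.
Proof.
move=> [_ _ Ffin].
pose c := Num.max 0 (fine (Xnorm P +oo%E F)).
have c0 : 0 <= c by rewrite le_max lexx.
exists c => //; apply: Xnorm_oo_sup_le => //.
move: Ffin; rewrite /c; case: (Xnorm P +oo%E F) => [r _|//|_]; last exact: leNye.
by rewrite lee_fin le_max lexx orbT.
Qed.

Variable V : R -> R -> Xpair.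
Hypothesis sol : forall T : R, 0 < T ->
  [/\ W1oo_loc_X2 P T (@toX R N \o U) (V T), cont_Xoo P T (@toX R N \o U),
      cont_form_dom P T U, weak_equation P f h T U (V T)
    & Xnorm P +oo%E (toX (U t) - toX U0) @[t --> 0^'+] --> 0%E].
Hypotheses (dom0 : form_dom P U0) (inX0 : inX P +oo%E (toX U0)).

(** [pairing t] is the contribution of the nonlinearities to the equation, and
[velocity t] is what the equation prescribes for the time derivative of [U];
unlike the weak derivative [V], it is defined at every positive time. *)
Definition pairing (t : R) (xi : state) : R :=
  \int[muS P]_(x in Sg P) (h ((U t).2 x) * xi.2 x) -
  \int[lam P]_(x in OmS P) (f ((U t).1.1 x) * xi.1.1 x).

Definition velocity (t : R) (xi : state) : R :=
  pairing t xi - Defs.form P (U t) xi.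

Lemma solution_dom (t : R) : 0 < t -> form_dom P (U t).
Proof.
move=> t0; have [_ _ c _ _] := sol t0.
by have [] := c t (_ : 0 < t <= t); rewrite ?t0 ?lexx.
Qed.

Lemma solution_L2state (t : R) : 0 < t -> L2state P (U t).
Proof. by move=> /solution_dom; exact: form_dom_L2state. Qed.

Lemma U0_L2state : L2state P U0.
Proof. exact: form_dom_L2state. Qed.

Lemma solution_inX (t : R) : 0 < t -> inX P +oo%E (toX (U t)).
Proof.
move=> t0; have [_ c _ _ _] := sol t0.
by have [] := c t (_ : 0 <= t <= t); rewrite ?(ltW t0) ?lexx.
Qed.

Lemma solution_measurable (t : R) : 0 < t -> measurable_pair (toX (U t)).
Proof. by move=> /solution_inX; exact: inX_measurable_pair. Qed.

Lemma U0_measurable : measurable_pair (toX U0).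
Proof. exact: inX_measurable_pair inX0. Qed.

Lemma solution_sup_cont (t e : R) : 0 < t -> 0 < e ->
  \forall s \near t, sup_le P (toX (U s) - toX (U t)) e.
Proof.
move=> t0 e0; have T0 : 0 < t + 1 by rewrite addr_gt0.
have [_ c _ _ _] := sol T0.
have tT : 0 <= t <= t + 1 by rewrite (ltW t0) lerDl ler01.
have [_ ct] := c t tT.
have H := ereal_cvg0_le e0 ct.
have H' : \forall s \near t, `[0, t + 1]%classic s ->
    (Xnorm P +oo (toX (U s) - toX (U t))%R <= e%:E)%E by exact: H.
near=> s; apply: Xnorm_oo_sup_le; first exact: ltW.
have : `[0, t + 1]%classic s -> (Xnorm P +oo (toX (U s) - toX (U t))%R <= e%:E)%E.
  by near: s.
apply; rewrite /= in_itv/=; apply/andP; split; apply: ltW; near: s.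
- exact: lt_nbhsr.
- by apply: lt_nbhsl; rewrite ltrDl.
Unshelve. all: by end_near. Qed.

Lemma solution_sup_init (e : R) : 0 < e ->
  \forall s \near 0^'+, sup_le P (toX (U s) - toX U0) e.
Proof.
move=> e0; have [_ _ _ _ c] := sol (@ltr01 R).
have H := ereal_cvg0_le e0 c.
near=> s; apply: (Xnorm_oo_sup_le (ltW e0)); near: s; exact: H.
Unshelve. all: by end_near. Qed.

Definition bounded_pair (M : R) (F : Xpair) : Prop :=
  bounded_by (lam P) (OmS P : set B) M F.1 /\
  bounded_by (muS P) (Sg P : set B) M F.2.

Lemma solution_bounded (t : R) : 0 < t -> exists M : R,
  \forall s \near t, 0 < s /\ bounded_pair M (toX (U s)).
Proof.
move=> t0; have [c c0 Uc] := inXoo_sup_le (solution_inX t0).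
exists (c + 1); near=> s.
have s0 : 0 < s by near: s; exact: lt_nbhsr.
split => //; apply: sup_le_bounded_by; first exact: solution_measurable.
apply: sup_le_near Uc; near: s; exact: solution_sup_cont.
Unshelve. all: by end_near. Qed.

Lemma solution_bounded_init : exists M : R, bounded_pair M (toX U0) /\
  \forall s \near 0^'+, 0 < s /\ bounded_pair M (toX (U s)).
Proof.
have [c c0 Uc] := inXoo_sup_le inX0.
exists (c + 1); split.
  apply: sup_le_bounded_by; first exact: U0_measurable.
  by have [u1 u2] := Uc; split; [apply: ae_impl u1|apply: ae_impl u2] => x H Dx;
    apply: le_trans (H Dx) _; rewrite lerDl.
near=> s.
have s0 : 0 < s by near: s; exact: nbhs_right_gt.
split => //; apply: sup_le_bounded_by; first exact: solution_measurable.
apply: sup_le_near Uc; near: s; exact: solution_sup_init.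
Unshelve. all: by end_near. Qed.

(** Uniform convergence implies convergence in X^2, since both measures are
finite. *)
Lemma sup_X2ip_cvg (F : set_system R) {FF : ProperFilter F} (W : state) :
  measurable_pair (toX W) ->
  (\forall s \near F, measurable_pair (toX (U s))) ->
  (forall e : R, 0 < e -> \forall s \near F, sup_le P (toX (U s) - toX W) e) ->
  X2ip P (toX (U s - W)) (toX (U s - W)) @[s --> F] --> (0 : R).
Proof.
move=> mW mU H; apply/cvgrPdist_le => e e0.
have M0 : 0 < m1 + m2 + 1 by rewrite ltr_wpDl// addr_ge0.
pose k := Num.sqrt (e / (m1 + m2 + 1)).
have k0 : 0 < k by rewrite sqrtr_gt0 divr_gt0.
near=> s.
have [L2 le] : L2pair P (toX (U s) - toX W) /\
    X2ip P (toX (U s) - toX W) (toX (U s) - toX W) <= k ^+ 2 * (m1 + m2).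
  apply: sup_le_X2ip; last by near: s; exact: H.
  by apply: measurable_pairB => //; near: s.
rewrite -[toX (U s - W)]/(toX (U s) - toX W) sub0r normrN.
rewrite ger0_norm; last exact: (psd_ge0 (X2ip_psd geo) L2).
apply: (le_trans le); rewrite sqr_sqrtr; last by rewrite divr_ge0// ltW.
rewrite mulrAC ler_pdivrMr// ler_pM2l// lerDl ler01//.
Unshelve. all: by end_near. Qed.

Lemma solution_X2_cvg (t : R) : 0 < t ->
  X2ip P (toX (U s - U t)) (toX (U s - U t)) @[s --> t] --> (0 : R).
Proof.
move=> t0; apply: (@sup_X2ip_cvg (nbhs t) _ (U t)).
- exact: solution_measurable.
- near=> s; apply: solution_measurable; near: s; exact: lt_nbhsr.
- by move=> e; exact: solution_sup_cont.
Unshelve. all: by end_near. Qed.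

Lemma solution_X2_init :
  X2ip P (toX (U s - U0)) (toX (U s - U0)) @[s --> 0^'+] --> (0 : R).
Proof.
apply: (@sup_X2ip_cvg _ _ U0).
- exact: U0_measurable.
- near=> s; apply: solution_measurable; near: s; exact: nbhs_right_gt.
- exact: solution_sup_init.
Unshelve. all: by end_near. Qed.

Lemma solution_form_cvg (t : R) : 0 < t ->
  Defs.form P (U s - U t) (U s - U t) @[s --> t] --> (0 : R).
Proof.
move=> t0; have T0 : 0 < t + 1 by rewrite addr_gt0.
have [_ _ c _ _] := sol T0.
have tT : 0 < t <= t + 1 by rewrite t0 lerDl ler01.
have [_ ct] := c t tT.
apply/cvgrPdist_le => e e0.
have H : \forall s \near t, `]0, t + 1]%classic s ->
    `|0 - Defs.form P (U s - U t) (U s - U t)| <= e.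
  exact: (@cvgr_dist_le _ _ _ _ _ _ _ ct _ e0).
near=> s.
have : `]0, t + 1]%classic s -> `|0 - Defs.form P (U s - U t) (U s - U t)| <= e.
  by near: s.
apply; rewrite /= in_itv/=; apply/andP; split; last apply: ltW; near: s.
- exact: lt_nbhsr.
- by apply: lt_nbhsl; rewrite ltrDl.
Unshelve. all: by end_near. Qed.

Let sL2 := L2state_subspace geo.
Let fP := form_psd geo coef.
Let bP := X2ip_state_psd geo.

Lemma pairing_cvg (t : R) (xi : state) : 0 < t -> L2state P xi ->
  pairing s xi @[s --> t] --> pairing t xi.
Proof.
move=> t0 [[x1 x2] _ _]; have [M HM] := solution_bounded t0.
have [Kf Kf0 HKf] := C1_bounded M Cf; have [Kh Kh0 HKh] := C1_bounded M Ch.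
pose I1 := \int[lam P]_(x in OmS P) `|xi.1.1 x|.
pose I2 := \int[muS P]_(x in Sg P) `|xi.2 x|.
have I10 : 0 <= I1 by apply: Rintegral_ge0.
have I20 : 0 <= I2 by apply: Rintegral_ge0.
pose K := Kf * I1 + Kh * I2 + 1.
have K0 : 0 < K by rewrite ltr_wpDl// addr_ge0// mulr_ge0.
apply/cvgrPdist_le => e e0.
have k0 : 0 < e / K by rewrite divr_gt0.
have [_ [bt1 bt2]] := nbhs_singleton HM.
near=> s.
have [s0 [bs1 bs2]] : 0 < s /\ bounded_pair M (toX (U s)) by near: s.
have [d1 d2] : sup_le P (toX (U s) - toX (U t)) (e / K).
  by near: s; exact: solution_sup_cont.
have d1' : {ae lam P, forall x, OmS P x -> `|(U s).1.1 x - (U t).1.1 x| <= e / K}.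
  by apply: ae_impl d1 => x H /OmS_Om; exact: H.
have E1 := superposition_pairing_continuous mD1 fin1 Cf Kf0 HKf (ltW k0) bs1 bt1 x1 d1'.
have E2 := superposition_pairing_continuous mD2 fin2 Ch Kh0 HKh (ltW k0) bs2 bt2 x2 d2.
have eK : e = e / K * (Kf * I1) + e / K * (Kh * I2) + e / K.
  by rewrite -[in LHS](divfK (_ : K != 0) e) ?gt_eqF// /K; ring.
rewrite distrC; apply: (@le_trans _ _ (e / K * (Kf * I1) + e / K * (Kh * I2))).
  by rewrite [leRHS]addrC; exact: (normr_subB_le E2 E1).
by rewrite [leRHS]eK lerDl ltW.
Unshelve. all: by end_near. Qed.

Lemma velocity_cvg (t : R) (xi : state) : 0 < t -> L2state P xi ->
  velocity s xi @[s --> t] --> velocity t xi.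
Proof.
move=> t0 Zxi; apply: cvgB; first exact: pairing_cvg.
apply: (@psd_pairing_cvg R _ (L2state P) (Defs.form P) R (nbhs t) _ U (U t) xi
  sL2 fP (solution_L2state t0) Zxi).
  near=> s; apply: solution_L2state; near: s; exact: lt_nbhsr.
exact: solution_form_cvg.
Unshelve. all: by end_near. Qed.

Lemma pairing_linear (t : R) : 0 < t -> linear_on (L2state P) (pairing t).
Proof.
move=> t0; have [M /nbhs_singleton[_ [b1 b2]]] := solution_bounded t0.
have [Kf Kf0 HKf] := C1_bounded M Cf; have [Kh Kh0 HKh] := C1_bounded M Ch.
have sf := superposition_square_integrable mD1 fin1 Cf HKf b1.
have sh := superposition_square_integrable mD2 fin2 Ch HKh b2.
move=> c xi zeta [[x1 x2] _ _] [[z1 z2] _ _].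
have E1 := linear_on_Rintegral_mul mD1 sf c x1 z1.
have E2 := linear_on_Rintegral_mul mD2 sh c x2 z2.
apply: (etrans (congr2 (fun p q => p - q) E2 E1)).
by rewrite opprD addrACA -mulrBr.
Qed.

Lemma velocity_linear (t : R) : 0 < t -> linear_on (L2state P) (velocity t).
Proof.
move=> t0; apply: linear_on_sub; first exact: pairing_linear.
exact: psd_linearr sL2 fP _ (solution_L2state t0).
Qed.

(** The exceptional null set in the weak equation depends on the test state,
so the states for which it holds are collected in a vector space. *)
Definition tested (xi : state) : Prop := L2state P xi /\
  forall T : R, 0 < T -> {ae lebesgue_measure, forall t : R, 0 < t < T ->
    velocity t xi = X2ip P (V T t) (toX xi)}.

Lemma derivative_inX (T : R) : 0 < T ->
  {ae lebesgue_measure, forall t : R, 0 < t < T -> inX P 2%:E (V T t)}.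
Proof.
move=> T0; have [[_ [[S _ HS] _] _] _ _ _ _] := sol T0.
by apply: ae_impl HS => t H tT; have [] := H tT.
Qed.

Lemma tested_subspace : subspace tested.
Proof.
move=> c xi zeta [Z1 H1] [Z2 H2]; split; first exact: sL2.
move=> T T0; have i := derivative_inX T0.
apply: ae_impl2 i (ae_impl2 (fun t => @conj _ _) (H1 T T0) (H2 T T0)).
move=> t it [h1 h2] tT; have [t0 _] := andP tT.
rewrite velocity_linear// h1// h2//.
rewrite -[toX (c *: xi + zeta)]/(c *: toX xi + toX zeta).
have [L1 _ _] := Z1; have [L2 _ _] := Z2.
by rewrite (psd_linearr (L2pair_subspace geo) (X2ip_psd geo) (inX2_L2pair geo (it tT))).
Qed.

Lemma form_dom_tested (xi : state) : form_dom P xi -> tested xi.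
Proof.
move=> dxi; split; first exact: form_dom_L2state.
move=> T T0; have [_ _ _ w _] := sol T0.
apply: ae_impl (w xi dxi) => t H tT; have := H tT.
have -> : X2ip P (V T t) (toX xi) =
  \int[lam P]_(x in OmS P) ((V T t).1 x * xi.1.1 x) +
  \int[muS P]_(x in Sg P) ((V T t).2 x * xi.2 x) by [].
by rewrite /velocity /pairing; lra.
Qed.

(** A state is measurable on the complement of Sigma only; cut off there, it
can be tested in the definition of the weak time derivative. *)
Lemma L2state_cutoff_inX (xi : state) : L2state P xi ->
  inX P 2%:E (xi.1.1 \_ (OmS P), xi.2).
Proof.
move=> [[[mx ix] [my iy]] _ _]; have mO := measurable_Om geo.
split; [rewrite /=|exact: my|].
  apply/(measurable_restrict _ mD1 mO).
  by rewrite (_ : Om P `&` OmS P = OmS P)//; apply/setIidPr; exact: OmS_Om.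
rewrite Xnorm2E; apply: poweR_lty; rewrite /X2sqr /= lte_add_pinfty//.
- rewrite [X in (X < _)%E](_ : _ = \int[lam P]_(x in OmS P) (xi.1.1 x ^+ 2)%:E)%E.
    exact: (integrable_lty mD1 ix).
  rewrite -[in RHS](setIidr (OmS_Om (P := P))) integral_mkcondr.
  apply: eq_integral => x _; rewrite !patchE; case: ifP => // _.
  by rewrite expr0n.
- exact: (integrable_lty mD2 iy).
Qed.

Lemma X2dot_cutoff (F : Xpair) (xi : state) :
  X2dot P F (xi.1.1 \_ (OmS P), xi.2) = X2ip P F (toX xi).
Proof.
rewrite /X2dot /X2ip /=; congr (_ + _).
rewrite -[in RHS](setIidr (OmS_Om (P := P))) Rintegral_mkcondr.
apply: eq_Rintegral => x _; rewrite !patchE; case: ifP => // _.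
by rewrite mulr0.
Qed.

(** Almost everywhere the weak derivative of the left-hand side is
[velocity _ xi], which is continuous. *)
Lemma solution_derive (xi : state) (t : R) : tested xi -> 0 < t ->
  is_derive t 1 (fun s => X2ip P (toX (U s)) (toX xi)) (velocity t xi).
Proof.
move=> [Zxi txi] t0; have T0 : 0 < t + 1 by rewrite addr_gt0.
apply: (@dubois_reymond R (t + 1) (fun s => X2ip P (toX (U s)) (toX xi))
  (fun s => velocity s xi)) => //; last by rewrite ltrDl.
- move=> s s0 _.
  apply: (@psd_pairing_cvg R _ (L2state P) (fun W W' => X2ip P (toX W) (toX W'))
    R (nbhs s) _ U (U s) xi sL2 bP (solution_L2state s0) Zxi).
    near=> r; apply: solution_L2state; near: r; exact: lt_nbhsr.
  exact: solution_X2_cvg.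
- by move=> s s0 _; exact: velocity_cvg.
move=> eta Heta; have [[_ _ H] _ _ _ _] := sol T0.
have := H eta _ Heta (L2state_cutoff_inX Zxi).
have -> : \int[lebesgue_measure]_(s in `]0, t + 1[)
    (derive1 eta s * X2dot P ((@toX R N \o U) s) (xi.1.1 \_ (OmS P), xi.2)) =
  \int[lebesgue_measure]_(s in `]0, t + 1[)
    (derive1 eta s * X2ip P (toX (U s)) (toX xi)).
  by apply: eq_Rintegral => s _; rewrite X2dot_cutoff.
move=> ->; congr (- _); apply: Rintegral_congr_ae.
apply: ae_impl (txi _ T0) => s E; rewrite /= in_itv/= => sT.
by rewrite X2dot_cutoff E.
Unshelve. all: by end_near. Qed.

(** The bound on the weak derivative [V] holds almost everywhere, and passes to
every positive time by continuity of [velocity _ xi]. *)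
Lemma velocity_bounded (t : R) : 0 < t -> exists C : R, \forall s \near t,
  forall xi, tested xi ->
    `|velocity s xi| <= C * Num.sqrt (X2ip P (toX xi) (toX xi)).
Proof.
move=> t0; have T0 : 0 < t + 1 by rewrite addr_gt0.
have [[_ [_ HV] _] _ _ _ _] := sol T0.
have t2 : 0 < t / 2 < t + 1 by apply/andP; split; lra.
have [C HC] := HV _ t2.
exists `|C|; near=> s => xi [Zxi txi].
have ts : t / 2 < s by near: s; apply: lt_nbhsr; lra.
have sT : s < t + 1 by near: s; apply: lt_nbhsl; lra.
have s0 : 0 < s by lra.
apply: (@ae_le_continuous R (fun r => `|velocity r xi|) (t / 2) (t + 1) _ s) => //.
  have i := derivative_inX T0.
  apply: ae_impl2 i (ae_impl2 (fun t => @conj _ _) HC (txi _ T0)).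
  move=> r ir [hC hv] tr rT.
  have rT' : 0 < r < t + 1 by apply/andP; split; lra.
  have rT2 : t / 2 < r < t + 1 by rewrite tr rT.
  rewrite hv//; have [Lxi _ _] := Zxi.
  apply: (le_trans (psd_CS_sqrt (L2pair_subspace geo) (X2ip_psd geo)
    (inX2_L2pair geo (ir rT')) Lxi)).
  rewrite ler_wpM2r ?sqrtr_ge0// -sqrtr_sqr ler_wsqrtr//.
  exact: (Xnorm2_le geo (ir rT') (hC rT2)).
by apply: continuous_comp; [exact: velocity_cvg|exact: norm_continuous].
Unshelve. all: by end_near. Qed.

Definition potential (W : state) : R :=
  \int[lam P]_(x in OmS P) antideriv f (W.1.1 x)
  - \int[muS P]_(x in Sg P) antideriv h (W.2 x).

Lemma potential_expansion (t : R) : 0 < t -> exists C : R, \forall s \near t,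
  `|potential (U s) - potential (U t) + pairing t (U s - U t)| <=
    C * X2ip P (toX (U s - U t)) (toX (U s - U t)).
Proof.
move=> t0; have [M HM] := solution_bounded t0.
have [Kf Kf0 HKf] := C1_bounded M Cf; have [Kh Kh0 HKh] := C1_bounded M Ch.
have [_ [bt1 bt2]] := nbhs_singleton HM.
exists (Kf + Kh); near=> s.
have [s0 [bs1 bs2]] : 0 < s /\ bounded_pair M (toX (U s)) by near: s.
have E1 := antideriv_expansion mD1 fin1 Cf Kf0 HKf bs1 bt1.
have E2 := antideriv_expansion mD2 fin2 Ch Kh0 HKh bs2 bt2.
pose I1 := \int[lam P]_(x in OmS P) (((U s).1.1 x - (U t).1.1 x) * ((U s).1.1 x - (U t).1.1 x)).
pose I2 := \int[muS P]_(x in Sg P) (((U s).2 x - (U t).2 x) * ((U s).2 x - (U t).2 x)).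
pose J1 := \int[lam P]_(x in OmS P) (f ((U t).1.1 x) * ((U s).1.1 x - (U t).1.1 x)).
pose J2 := \int[muS P]_(x in Sg P) (h ((U t).2 x) * ((U s).2 x - (U t).2 x)).
have -> : pairing t (U s - U t) = J2 - J1 by [].
have -> : X2ip P (toX (U s - U t)) (toX (U s - U t)) = I1 + I2 by [].
have I10 : 0 <= I1 by apply: Rintegral_ge0 => x _; rewrite -expr2 sqr_ge0.
have I20 : 0 <= I2 by apply: Rintegral_ge0 => x _; rewrite -expr2 sqr_ge0.
move: E1 E2; rewrite -/I1 -/I2 -/J1 -/J2 /potential.
move: (\int[lam P]_(x in OmS P) antideriv f ((U s).1.1 x)) => A1.
move: (\int[lam P]_(x in OmS P) antideriv f ((U t).1.1 x)) => A2.
move: (\int[muS P]_(x in Sg P) antideriv h ((U s).2 x)) => B1.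
move: (\int[muS P]_(x in Sg P) antideriv h ((U t).2 x)) => B2.
move: (mulr_ge0 Kf0 I20) (mulr_ge0 Kh0 I10).
clearbody I1 I2 J1 J2; rewrite !ler_norml => ? ? /andP[? ?] /andP[? ?].
by apply/andP; split; lra.
Unshelve. all: by end_near. Qed.

Lemma potential_init : potential (U t) @[t --> 0^'+] --> potential U0.
Proof.
have [M [[b1 b2] HM]] := solution_bounded_init.
have [Kf Kf0 HKf] := C1_bounded M Cf; have [Kh Kh0 HKh] := C1_bounded M Ch.
pose K := Kf * m1 + Kh * m2 + 1.
have K0 : 0 < K by rewrite ltr_wpDl// addr_ge0// mulr_ge0.
apply/cvgrPdist_le => e e0.
have k0 : 0 < e / K by rewrite divr_gt0.
near=> s.
have [s0 [bs1 bs2]] : 0 < s /\ bounded_pair M (toX (U s)) by near: s.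
have [d1 d2] : sup_le P (toX (U s) - toX U0) (e / K).
  by near: s; exact: solution_sup_init.
have d1' : {ae lam P, forall x, OmS P x -> `|(U s).1.1 x - U0.1.1 x| <= e / K}.
  by apply: ae_impl d1 => x H /OmS_Om; exact: H.
have E1 := antideriv_continuous_bound mD1 fin1 Cf Kf0 HKf (ltW k0) bs1 b1 d1'.
have E2 := antideriv_continuous_bound mD2 fin2 Ch Kh0 HKh (ltW k0) bs2 b2 d2.
have eK : e = e / K * (Kf * m1) + e / K * (Kh * m2) + e / K.
  by rewrite -[in LHS](divfK (_ : K != 0) e) ?gt_eqF// /K; ring.
rewrite distrC; apply: (@le_trans _ _ (e / K * (Kf * m1) + e / K * (Kh * m2))).
  exact: (normr_subB_le E1 E2).
by rewrite [leRHS]eK lerDl ltW.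
Unshelve. all: by end_near. Qed.

Lemma pairing_init : pairing t (U t - U0) @[t --> 0^'+] --> (0 : R).
Proof.
have [M [[b1 b2] HM]] := solution_bounded_init.
have [Kf Kf0 HKf] := C1_bounded M Cf; have [Kh Kh0 HKh] := C1_bounded M Ch.
pose K := Kf * m1 + Kh * m2 + 1.
have K0 : 0 < K by rewrite ltr_wpDl// addr_ge0// mulr_ge0.
apply/cvgrPdist_le => e e0.
have k0 : 0 < e / K by rewrite divr_gt0.
near=> s.
have [s0 [bs1 bs2]] : 0 < s /\ bounded_pair M (toX (U s)) by near: s.
have sd : sup_le P (toX (U s) - toX U0) (e / K).
  by near: s; exact: solution_sup_init.
have [d1 d2] := sup_le_bounded_by
  (measurable_pairB (solution_measurable s0) U0_measurable) sd.
have E1 := superposition_pairing_bounded mD1 fin1 Cf Kf0 HKf (ltW k0) bs1 d1.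
have E2 := superposition_pairing_bounded mD2 fin2 Ch Kh0 HKh (ltW k0) bs2 d2.
have eK : e = e / K * (Kf * m1) + e / K * (Kh * m2) + e / K.
  by rewrite -[in LHS](divfK (_ : K != 0) e) ?gt_eqF// /K; ring.
rewrite sub0r normrN.
apply: (le_trans (ler_normB _ _)); rewrite [leRHS]eK (addrC (e / K * _)).
by rewrite -[leLHS]addr0; apply: lerD; [exact: lerD|exact: ltW].
Unshelve. all: by end_near. Qed.

(** The structural conditions on [f] and [h], integrated; the excess
[(alpha / 2 - 1) * form] left over from [alpha * E] is turned into a multiple
of the X^2 norm by the norm equivalence. *)
Lemma energy_growth (alpha cf ch cf' ch' kappa : R) (t : R) : 0 < t ->
  2 < alpha -> 0 <= cf' -> 0 <= ch' ->
  form_norm_equiv P kappa ->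
  (forall tau, f tau * tau - alpha * antideriv f tau <= - cf * tau ^+ 2 + cf') ->
  (forall tau, ch * tau ^+ 2 - ch' <= h tau * tau - alpha * antideriv h tau) ->
  ((alpha / 2 - 1) * kappa + Num.min cf ch) * X2ip P (toX (U t)) (toX (U t))
    - alpha * (Defs.form P (U t) (U t) / 2 + potential (U t))
    - (cf' * m1 + ch' * m2) <= velocity t (U t).
Proof.
move=> t0 a2 cf'0 ch'0 eqv Hf Hh.
have [M /nbhs_singleton[_ [b1 b2]]] := solution_bounded t0.
have [Kf Kf0 HKf] := C1_bounded M Cf; have [Kh Kh0 HKh] := C1_bounded M Ch.
have Hf' tau : cf * tau ^+ 2 - cf' <= -1 * (f tau * tau - alpha * antideriv f tau).
  by have := Hf tau; lra.
have Hh' tau : ch * tau ^+ 2 - ch' <= 1 * (h tau * tau - alpha * antideriv h tau).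
  by rewrite mul1r.
have G1 := superposition_growth mD1 fin1 Cf Kf0 HKf b1 Hf'.
have G2 := superposition_growth mD2 fin2 Ch Kh0 HKh b2 Hh'.
have Zt := solution_L2state t0; have [Lt _ _] := Zt.
have [mt _ _] := solution_inX t0.
have Fk : kappa * X2ip P (toX (U t)) (toX (U t)) <= Defs.form P (U t) (U t).
  by rewrite -(Xnorm2_sqr geo mt Lt); apply: eqv; exact: solution_dom.
pose I1 := \int[lam P]_(x in OmS P) ((U t).1.1 x * (U t).1.1 x).
pose I2 := \int[muS P]_(x in Sg P) ((U t).2 x * (U t).2 x).
have I10 : 0 <= I1 by apply: Rintegral_ge0 => x _; rewrite -expr2 sqr_ge0.
have I20 : 0 <= I2 by apply: Rintegral_ge0 => x _; rewrite -expr2 sqr_ge0.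
have XE : X2ip P (toX (U t)) (toX (U t)) = I1 + I2 by [].
pose A := \int[lam P]_(x in OmS P) (f ((U t).1.1 x) * (U t).1.1 x).
pose Bh := \int[muS P]_(x in Sg P) (h ((U t).2 x) * (U t).2 x).
pose FA := \int[lam P]_(x in OmS P) antideriv f ((U t).1.1 x).
pose FB := \int[muS P]_(x in Sg P) antideriv h ((U t).2 x).
have {}G1 : cf * I1 - cf' * m1 <= -1 * (A - alpha * FA) by exact: G1.
have {}G2 : ch * I2 - ch' * m2 <= 1 * (Bh - alpha * FB) by exact: G2.
have -> : velocity t (U t) = Bh - A - Defs.form P (U t) (U t) by [].
have -> : potential (U t) = FA - FB by [].
move: Fk; rewrite XE.
clearbody I1 I2 A Bh FA FB; move: (Defs.form P (U t) (U t)) => F Fk.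
have mf : Num.min cf ch * I1 <= cf * I1 by rewrite ler_wpM2r// ge_min lexx.
have mh : Num.min cf ch * I2 <= ch * I2 by rewrite ler_wpM2r// ge_min lexx orbT.
have a20 : 0 <= alpha / 2 - 1 by rewrite subr_ge0 ler_pdivlMr// mul1r ltW.
have := ler_wpM2l a20 Fk.
move: G1 G2 mf mh; move: (Num.min cf ch) => m; move: (m1) (m2) => n1 n2.
by move=> *; lra.
Qed.

Theorem solution_not_global (alpha cf ch cf' ch' kappa : R) :
  2 < alpha -> 0 <= cf -> 0 <= ch -> 0 <= cf' -> 0 <= ch' -> 0 <= kappa ->
  form_norm_equiv P kappa ->
  (forall tau, f tau * tau - alpha * antideriv f tau <= - cf * tau ^+ 2 + cf') ->
  (forall tau, ch * tau ^+ 2 - ch' <= h tau * tau - alpha * antideriv h tau) ->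
  ((alpha / 2 - 1) * kappa + Num.min cf ch) *
    fine (Xnorm P 2%:E (toX U0)) ^+ 2 <=
  alpha * energy P f h U0 + (cf' * m1 + ch' * m2).
Proof.
move=> a2 cf0 ch0 cf'0 ch'0 k0 eqv Hf Hh.
have [mU0 _ _] := inX0; have [L0 _ _] := U0_L2state.
rewrite (Xnorm2_sqr geo mU0 L0).
have -> : energy P f h U0 = Defs.form P U0 U0 / 2 + potential U0.
  by rewrite /energy /potential mulrC addrA.
have tZ xi : tested xi -> L2state P xi by case.
have D10 : 0 <= (alpha / 2 - 1) * kappa + Num.min cf ch.
  rewrite addr_ge0//; last by rewrite le_min cf0.
  by rewrite mulr_ge0// subr_ge0 ler_pdivlMr// mul1r ltW.
apply: (@flow_no_blow_up_bound R _ tested (fun W W' => X2ip P (toX W) (toX W'))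
  (Defs.form P) pairing U U0 (potential \o U) (potential U0) alpha _ _ a2 D10).
- exact: tested_subspace.
- exact: psd_on_sub tZ bP.
- exact: psd_on_sub tZ fP.
- by move=> t t0 c x y /tZ Zx /tZ Zy; exact: pairing_linear.
- by move=> t t0; apply: form_dom_tested; exact: solution_dom.
- exact: form_dom_tested.
- by move=> xi t txi t0; exact: solution_derive.
- exact: velocity_bounded.
- exact: solution_form_cvg.
- exact: potential_expansion.
- exact: potential_init.
- exact: solution_X2_init.
- exact: pairing_init.
- by move=> t t0; exact: energy_growth.
Qed.

End Flow.

Theorem theorem5p3 (R : realType) (alpha Cf Ch Cf' Ch' mO mS kappa : R)
    (halpha : 2 < alpha)
    (hCf : 0 <= Cf) (hCh : 0 <= Ch) (hCf' : 0 <= Cf') (hCh' : 0 <= Ch')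
    (hkappa : 0 <= kappa) (hpos : 0 < kappa \/ (0 < Cf /\ 0 < Ch)) :
  exists D1 D2 : R, [/\ 0 < D1, 0 < D2 &
  forall (N : nat) (P : problem R N) (f h : R -> R),
    geometry P -> coefficients P -> extension_property P ->
    form_norm_equiv P kappa ->
    lam P (Om P) = mO%:E -> muS P (Sg P) = mS%:E ->
    C1 f -> C1 h ->
    (forall tau, f tau * tau - alpha * antideriv f tau
                   <= - Cf * tau ^+ 2 + Cf') ->
    (forall tau, Ch * tau ^+ 2 - Ch'
                   <= h tau * tau - alpha * antideriv h tau) ->
    forall U0, form_dom P U0 -> inX P +oo%E (toX U0) ->
      alpha * energy P f h U0 + D2
        < D1 * fine (Xnorm P 2%:E (toX U0)) ^+ 2 ->
      forall (Tmax : \bar R) U,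
        maximal_strong_solution P f h (toX U0) Tmax U ->
        (Tmax < +oo)%E].
Proof.
have a20 : 0 < alpha / 2 - 1 by rewrite subr_gt0 ltr_pdivlMr// mul1r.
have min0 : 0 <= Num.min Cf Ch by rewrite le_min hCf.
(* [D1] and [D2] are chosen before the domain, when [mO] and [mS] are not yet
   known to be measures, hence the absolute values; the term [1] makes [D2]
   positive. *)
exists ((alpha / 2 - 1) * kappa + Num.min Cf Ch).
exists (Cf' * `|mO| + Ch' * `|mS| + 1); split.
- case: hpos => [k0|[Cf0 Ch0]].
    by apply: ltr_wpDr => //; exact: mulr_gt0.
  apply: ltr_wpDl; first by apply: mulr_ge0 => //; exact: ltW.
  by rewrite lt_min Cf0.
- by apply: ltr_wpDl => //; apply: addr_ge0; exact: mulr_ge0.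
move=> N P f h geo coef _ eqv lamE muE Cff Chh Hf Hh U0 dom0 inX0 big Tmax U.
move=> [[_ _ sol] _]; rewrite ltNge leye_eq; apply/eqP => Ty.
have /choice[V HV] : forall T : R, exists W, 0 < T ->
  [/\ W1oo_loc_X2 P T (@toX R N \o U) W, cont_Xoo P T (@toX R N \o U),
      cont_form_dom P T U, weak_equation P f h T U W
    & Xnorm P +oo%E (toX (U t) - toX U0) @[t --> 0^'+] --> 0%E].
  move=> T; have [T0|T0] := ltP 0 T; last first.
    by exists (fun=> 0).
  have TT : (T%:E < Tmax)%E by rewrite Ty ltry.
  by have [W [w1 w2 w3 _ [w4 w5]]] := sol T T0 TT; exists W.
have lam_fin : (lam P (Om P) < +oo)%E by rewrite lamE ltry.
have := solution_not_global geo coef Cff Chh lam_fin HV dom0 inX0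
  halpha hCf hCh hCf' hCh' hkappa eqv Hf Hh.
apply/negP; rewrite -ltNge; apply: le_lt_trans big.
rewrite lerD2l -[leLHS]addr0; apply: lerD => //; apply: lerD; apply: ler_wpM2l => //.
- apply: (@le_trans _ _ (fine (lam P (Om P)))); last by rewrite lamE ler_norm.
  have mO' := measurable_Om geo; have mOS := measurable_OmS geo.
  apply: fine_le; last by apply: le_measure; rewrite ?inE//; exact: OmS_Om.
  + by rewrite ge0_fin_numE//; exact: lam_OmS_lty geo lam_fin.
  + by rewrite ge0_fin_numE.
- by rewrite muE ler_norm.
Qed.
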